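(* Let $R$ be a ring with unity and let $G$ be a complex of left $R$-modules. Then the following statements are equivalent: (1) $G$ is strongly Cartan-Eilenberg Gorenstein projective. (2) For each $n\in\mathbb{Z}$, $G_n$ is a projective left $R$-module and $\mathrm{Z}_n(G)$, $\mathrm{B}_n(G)$ and $\mathrm{H}_n(G)$ are Gorenstein projective left $R$-modules.
   Context: Complexes are complexes of left $R$-modules, graded homologically ($\delta_n:C_n\to C_{n-1}$), with $\mathrm{Z}_n(C)=\mathrm{Ker}(\delta_n)$, $\mathrm{B}_n(C)=\mathrm{Im}(\delta_{n+1})$, $\mathrm{H}_n(C)=\mathrm{Z}_n(C)/\mathrm{B}_n(C)$. $\mathrm{Hom}(C,D)$ is the abelian group of chain maps $C\to D$. $\mathrm{Z}(C)$, $\mathrm{B}(C)$, $\mathrm{H}(C)$, $C/\mathrm{Z}(C)$, $C/\mathrm{B}(C)$ denote the complexes with components $\mathrm{Z}_n(C)$, $\mathrm{B}_n(C)$, $\mathrm{H}_n(C)$, $C_n/\mathrm{Z}_n(C)$, $C_n/\mathrm{B}_n(C)$. A left $R$-module $M$ is Gorenstein projective if there is an exact sequence of projective left $R$-modules $\cdots\to P_{-1}\to P_0\to P_1\to\cdots$ with $M\cong\mathrm{Ker}(P_0\to P_1)$ which remains exact after applying $\mathrm{Hom}_R(-,P)$ for every projective left $R$-module $P$. A complex $P$ is C-E (Cartan-Eilenberg) projective if $P_n$, $\mathrm{Z}_n(P)$, $\mathrm{B}_n(P)$ and $\mathrm{H}_n(P)$ are projective modules for all $n\in\mathbb{Z}$.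 A sequence of complexes $\cdots\to C^{-1}\to C^0\to C^1\to\cdots$ is C-E exact if it is exact and the induced sequences of $\mathrm{Z}(C^i)$, of $\mathrm{B}(C^i)$, of $C^i/\mathrm{Z}(C^i)$, of $C^i/\mathrm{B}(C^i)$ and of $\mathrm{H}(C^i)$ are all exact. It is strongly C-E exact if it is C-E exact and degreewise split, i.e. for every $n$ the exact sequence of modules $\cdots\to C^{-1}_n\to C^0_n\to C^1_n\to\cdots$ is split (each of the short exact sequences into which it decomposes splits). A complex $G$ is strongly C-E (Cartan-Eilenberg) Gorenstein projective if there is a strongly C-E exact sequence of C-E projective complexes $\mathbb{P}:\cdots\to P^{-1}\to P^0\to P^1\to\cdots$ with $G\cong\mathrm{Ker}(P^0\to P^1)$ such that $\mathrm{Hom}(-,Q)$ leaves $\mathbb{P}$ exact for every C-E projective complex $Q$. *)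

(* Defs.v *)
From HB Require Import structures.
From mathcomp Require Import all_boot all_order all_algebra generic_quotient.
From mathcomp Require Import boolp.

Set Implicit Arguments.
Unset Strict Implicit.
Unset Printing Implicit Defensive.

Import GRing.Theory.
Local Open Scope ring_scope.
Local Open Scope quotient_scope.

(* [submodClosed] is defined over semirings, where closure under opposite is
   not automatic. *)
Lemma submodClosed_zmod (R : pzRingType) (V : lmodType R) (S : submodClosed V) :
  zmod_closed S.
Proof. exact: GRing.submod_closedB (GRing.submodClosedP S). Qed.

Section SubmodType.
Variables (R : pzRingType) (V : lmodType R) (S : submodClosed V).

Record submod : predArgType :=
  Submod { submod_val : V; submod_valP : submod_val \in S }.

HB.instance Definition _ := [isSub of submod for submod_val].
HB.instance Definition _ := [Choice of submod by <:].
HB.instance Definition _ := GRing.SubChoice_isSubZmodule.Build V _ submod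
  (submodClosed_zmod S).
HB.instance Definition _ := [SubZmodule_isSubLmodule of submod by <:].

End SubmodType.

Section QuotType.
Variables (R : pzRingType) (V : lmodType R) (S : submodClosed V).

Definition zmod_pred : {pred V} := S.
HB.instance Definition _ :=
  GRing.isZmodClosed.Build V zmod_pred (submodClosed_zmod S).

Definition quotmod : Type := Quotient.quot zmod_pred.

HB.instance Definition _ := GRing.Zmodule.on quotmod.

Definition quot_pi (x : V) : quotmod := \pi_(Quotient.quot zmod_pred) x.
Definition quot_repr (q : quotmod) : V := repr (q : Quotient.quot zmod_pred).

Lemma quot_reprK : cancel quot_repr quot_pi.
Proof. exact: reprK. Qed.

Lemma quot_piE (x y : V) : (quot_pi x == quot_pi y) = (x - y \in S).
Proof. by rewrite -(Quotient.idealrBE zmod_pred). Qed.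

Lemma quot_piD : {morph quot_pi : x y / x + y}.
Proof. exact: (raddfD (\pi_(Quotient.quot zmod_pred))). Qed.

Definition quot_scale (a : R) (q : quotmod) : quotmod :=
  quot_pi (a *: quot_repr q).

Lemma quot_piZ a (x : V) : quot_pi (a *: x) = quot_scale a (quot_pi x).
Proof.
by apply/eqP; rewrite quot_piE -scalerBr rpredZ// -quot_piE quot_reprK.
Qed.

Lemma quot_scaleA a b q : quot_scale a (quot_scale b q) = quot_scale (a * b) q.
Proof. by rewrite -[q]quot_reprK -!quot_piZ scalerA. Qed.

Lemma quot_scale1 : left_id 1 quot_scale.
Proof. by move=> q; rewrite -[q]quot_reprK -quot_piZ scale1r. Qed.

Lemma quot_scaleDr : right_distributive quot_scale +%R.
Proof.
move=> a q r; rewrite -[q]quot_reprK -[r]quot_reprK.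
by rewrite -quot_piD -!quot_piZ scalerDr quot_piD.
Qed.

Lemma quot_scaleDl q : {morph quot_scale^~ q : a b / a + b}.
Proof.
by move=> a b; rewrite -[q]quot_reprK -!quot_piZ scalerDl quot_piD.
Qed.

HB.instance Definition _ := GRing.Zmodule_isLmodule.Build R quotmod
  quot_scaleA quot_scale1 quot_scaleDr quot_scaleDl.

Lemma quot_pi_linear : linear quot_pi.
Proof. by move=> a x y; rewrite quot_piD quot_piZ. Qed.
HB.instance Definition _ :=
  GRing.isLinear.Build R V quotmod _ quot_pi quot_pi_linear.

End QuotType.

Section KerIm.
Variables (R : pzRingType) (V W : lmodType R) (f : {linear V -> W}).

Definition ker_mod : {pred V} := fun x => f x == 0.

Lemma ker_mod_closed : submod_closed ker_mod.
Proof.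
split=> [|a u v]; rewrite !unfold_in /ker_mod ?raddf0 // => /eqP fu /eqP fv.
by rewrite linearP fu fv scaler0 addr0.
Qed.
HB.instance Definition _ := GRing.isSubmodClosed.Build R V ker_mod ker_mod_closed.

Definition im_mod : {pred W} := fun y => `[< exists x, f x = y >].

Lemma im_mod_closed : submod_closed im_mod.
Proof.
split=> [|a u v]; rewrite !unfold_in.
  by apply/asboolP; exists 0; rewrite raddf0.
move=> /asboolP[x <-] /asboolP[y <-].
by apply/asboolP; exists (a *: x + y); rewrite linearP.
Qed.
HB.instance Definition _ := GRing.isSubmodClosed.Build R W im_mod im_mod_closed.

End KerIm.

(* [T] seen inside [S]: the submodule of [submod S] with underlying set the
   intersection of [S] and [T]. *)
Section Restrict.
Variables (R : pzRingType) (V : lmodType R) (S T : submodClosed V).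

Definition sub_in : {pred submod S} := fun x => val x \in T.

Lemma sub_in_closed : submod_closed sub_in.
Proof.
have E x : (x \in sub_in) = (val x \in T) by [].
split=> [|a u v]; rewrite !E; first exact: rpred0.
by move=> uT vT; rewrite /= rpredD ?rpredZ.
Qed.
HB.instance Definition _ :=
  GRing.isSubmodClosed.Build R (submod S) sub_in sub_in_closed.

End Restrict.
Arguments sub_in {R V} S T _.

Section InducedMaps.
Variables (R : pzRingType) (V W : lmodType R) (f : {linear V -> W}).
Variables (S : submodClosed V) (T : submodClosed W).
Hypothesis fST : {in S, forall x, f x \in T}.

Definition submod_map (x : submod S) : submod T := Submod (fST (valP x)).

Lemma submod_map_linear : linear submod_map.
Proof. by move=> a x y; apply: val_inj; rewrite /= linearP. Qed.
HB.instance Definition _ :=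
  GRing.isLinear.Build R (submod S) (submod T) _ submod_map submod_map_linear.

(* The idle [let] makes [quotmod_map] depend on [fST], so that its linear
   structure can be inferred. *)
Definition quotmod_map (q : quotmod S) : quotmod T :=
  let _ := fST in quot_pi T (f (quot_repr q)).

Lemma quotmod_map_pi x : quotmod_map (quot_pi S x) = quot_pi T (f x).
Proof.
by apply/eqP; rewrite quot_piE -raddfB fST// -quot_piE quot_reprK.
Qed.

Lemma quotmod_map_linear : linear quotmod_map.
Proof.
move=> a x y; rewrite -[x]quot_reprK -[y]quot_reprK.
by rewrite -linearP !quotmod_map_pi !linearP.
Qed.
HB.instance Definition _ := GRing.isLinear.Build R (quotmod S) (quotmod T) _
  quotmod_map quotmod_map_linear.

End InducedMaps.
Arguments submod_map {R V W f S T} fST x.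
Arguments quotmod_map {R V W f S T} fST q : simpl never.

Section Modules.
Variable R : pzRingType.
Implicit Types M N P : lmodType R.

Definition projective P : Prop :=
  forall M N (g : {linear M -> N}) (f : {linear P -> N}),
    (forall y, exists x, g x = y) ->
    exists h : {linear P -> M}, forall x, g (h x) = f x.

Definition mod_iso M N : Prop :=
  exists (f : {linear M -> N}) (g : {linear N -> M}), cancel f g /\ cancel g f.

Definition exact_at M N P (f : {linear M -> N}) (g : {linear N -> P}) : Prop :=
  forall y, g y = 0 <-> exists x, f x = y.

(* Every integer is of the form [i + 1], so this is exactness everywhere. *)
Definition exact_seq (M : int -> lmodType R)
    (f : forall i, {linear M i -> M (i + 1)}) : Prop :=
  forall i, exact_at (f i) (f (i + 1)).

(* [0 -> Ker (f i) -> M i -> Ker (f (i + 1)) -> 0] has a section for every [i]. *)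
Definition split_seq (M : int -> lmodType R)
    (f : forall i, {linear M i -> M (i + 1)}) : Prop :=
  forall i, exists s : {linear submod (ker_mod (f (i + 1))) -> M i},
    forall z, f i (s z) = val z.

(* Exactness of [Hom (M i+2) Q -> Hom (M i+1) Q -> Hom (M i) Q] for every [i]. *)
Definition hom_exact_seq (M : int -> lmodType R)
    (f : forall i, {linear M i -> M (i + 1)}) (Q : lmodType R) : Prop :=
  forall i (g : {linear M (i + 1) -> Q}),
    (forall x, g (f i x) = 0) <->
    exists h : {linear M (i + 1 + 1) -> Q}, forall y, h (f (i + 1) y) = g y.

Definition gorenstein_projective M : Prop :=
  exists (P : int -> lmodType R) (f : forall i, {linear P i -> P (i + 1)}),
    [/\ forall i, projective (P i),
        exact_seq f,
        mod_iso M (submod (ker_mod (f 0)))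
      & forall Q, projective Q -> hom_exact_seq f Q].

End Modules.

(* The differential is given as [C m -> C n] for every proof of [m = n + 1]
   (all such proofs are equal), which avoids transports along [n - 1 + 1 = n]. *)
Record complex (R : pzRingType) := Complex {
  cobj :> int -> lmodType R;
  cdiff : forall m n : int, m = n + 1 -> {linear cobj m -> cobj n};
  cdiffK : forall (m n p : int) (e : m = n + 1) (e' : n = p + 1) (x : cobj m),
    cdiff e' (cdiff e x) = 0 }.

Arguments cdiff {R} C {m n} e : rename.

Record chain_map (R : pzRingType) (C D : complex R) := ChainMap {
  cmap :> forall n : int, {linear C n -> D n};
  cmapE : forall (m n : int) (e : m = n + 1) (x : C m),
    cmap n (cdiff C e x) = cdiff D e (cmap m x) }.

Section ComplexTheory.
Variable R : pzRingType.
Implicit Types C D : complex R.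

Definition cycles C (n : int) : submodClosed (C n) :=
  ker_mod (cdiff C (esym (subrK 1 n))).
Definition boundaries C (n : int) : submodClosed (C n) :=
  im_mod (cdiff C (erefl (n + 1))).

Definition Zmod C n : lmodType R := submod (cycles C n).
Definition Bmod C n : lmodType R := submod (boundaries C n).
Definition Hmod C n : lmodType R := quotmod (sub_in (cycles C n) (boundaries C n)).
Definition CmodZ C n : lmodType R := quotmod (cycles C n).
Definition CmodB C n : lmodType R := quotmod (boundaries C n).

Section Induced.
Variables (C D : complex R) (f : chain_map C D) (n : int).

Lemma cycles_map : {in cycles C n, forall x, f n x \in cycles D n}.
Proof.
move=> x; rewrite !unfold_in /= /ker_mod -cmapE => /eqP->.
by rewrite raddf0.
Qed.

Lemma boundaries_map : {in boundaries C n, forall x, f n x \in boundaries D n}.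
Proof.
move=> _ /asboolP[x <-]; apply/asboolP; exists (f (n + 1) x).
by rewrite cmapE.
Qed.

Definition Zmap : {linear Zmod C n -> Zmod D n} := submod_map cycles_map.
Definition Bmap : {linear Bmod C n -> Bmod D n} := submod_map boundaries_map.
Definition CmodZ_map : {linear CmodZ C n -> CmodZ D n} := quotmod_map cycles_map.
Definition CmodB_map : {linear CmodB C n -> CmodB D n} :=
  quotmod_map boundaries_map.

Lemma Zmap_boundaries :
  {in sub_in (cycles C n) (boundaries C n),
    forall z, Zmap z \in sub_in (cycles D n) (boundaries D n)}.
Proof. by move=> z; rewrite !unfold_in /sub_in; apply: boundaries_map. Qed.

Definition Hmap : {linear Hmod C n -> Hmod D n} := quotmod_map Zmap_boundaries.

End Induced.

Section KernelComplex.
Variables (C D : complex R) (f : chain_map C D).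

Definition kerc_obj (n : int) : lmodType R := submod (ker_mod (f n)).

Lemma kerc_diff_subproof (m n : int) (e : m = n + 1) :
  {in ker_mod (f m), forall x, cdiff C e x \in ker_mod (f n)}.
Proof.
by move=> x; rewrite !unfold_in /ker_mod cmapE => /eqP->; rewrite raddf0.
Qed.

Definition kerc_diff (m n : int) (e : m = n + 1) :
    {linear kerc_obj m -> kerc_obj n} :=
  submod_map (kerc_diff_subproof e).

Lemma kerc_diffK (m n p : int) (e : m = n + 1) (e' : n = p + 1)
  (x : kerc_obj m) : kerc_diff e' (kerc_diff e x) = 0.
Proof. by apply: val_inj; rewrite /= cdiffK. Qed.

Definition ker_complex : complex R := Complex kerc_diffK.

End KernelComplex.

Definition complex_iso C D : Prop :=
  exists (f : chain_map C D) (g : chain_map D C),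
    forall n, cancel (f n) (g n) /\ cancel (g n) (f n).

Definition CE_projective C : Prop :=
  forall n, [/\ projective (C n), projective (Zmod C n),
                projective (Bmod C n) & projective (Hmod C n)].

Section Sequences.
Variables (C : int -> complex R) (f : forall i, chain_map (C i) (C (i + 1))).

Definition CE_exact : Prop :=
  (forall n, exact_seq (fun i => f i n)) /\
  [/\ forall n, exact_seq (fun i => Zmap (f i) n),
      forall n, exact_seq (fun i => Bmap (f i) n),
      forall n, exact_seq (fun i => CmodZ_map (f i) n),
      forall n, exact_seq (fun i => CmodB_map (f i) n)
    & forall n, exact_seq (fun i => Hmap (f i) n)].

Definition strongly_CE_exact : Prop :=
  CE_exact /\ forall n, split_seq (fun i => f i n).

Definition hom_exact_cseq (Q : complex R) : Prop :=
  forall i (g : chain_map (C (i + 1)) Q),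
    (forall n x, g n (f i n x) = 0) <->
    exists h : chain_map (C (i + 1 + 1)) Q,
      forall n y, h n (f (i + 1) n y) = g n y.

End Sequences.

Definition strongly_CE_gorenstein_projective (G : complex R) : Prop :=
  exists (P : int -> complex R) (f : forall i, chain_map (P i) (P (i + 1))),
    [/\ forall i, CE_projective (P i),
        strongly_CE_exact f,
        complex_iso G (ker_complex (f 0))
      & forall Q, CE_projective Q -> hom_exact_cseq f Q].

End ComplexTheory.

(* Main.v *)
From HB Require Import structures.
Require Import Defs.
From mathcomp Require Import all_boot all_order all_algebra.
From mathcomp Require Import boolp.

(* (1) => (2).  Maps [C n -> Q] killing the boundaries are the chain maps from [C]
   to a C-E projective complex concentrated in degree [n], so [Hom(-, Q)] is
   exact on the sequence of the [P^i_n / B_n(P^i)]; it is exact on the split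
   sequence of the [P^i_n].  The degreewise split sequences relating [B], [Z],
   [H] and [C/B] then give exactness on the sequences of [B_n(P^i)],
   [Z_n(P^i)] and [H_n(P^i)], which are complete resolutions of [B_n(G)],
   [Z_n(G)] and [H_n(G)].

   (2) => (1).  Consider the complexes [G] with [G_n] projective and [B_n(G)],
   [H_n(G)] Gorenstein projective.  Embeddings (resp. covers) of [B_n] and [H_n]
   by projectives [PB_n], [PH_n] assemble, since [Ext^1] from a Gorenstein
   projective module to a projective one vanishes, into an embedding (resp. a
   cover) of [G] by the C-E projective complex with components
   [PB_n + PH_n + PB_(n-1)], whose cokernel (resp. kernel) is again of this kind.
   Iterating in both directions and splicing yields the required sequence. *)

Set Implicit Arguments.
Unset Strict Implicit.
Unset Printing Implicit Defensive.

Import GRing.Theory.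
Local Open Scope ring_scope.

(** * Modules *)

Section Modules.
Variable R : pzRingType.
Implicit Types A B C E H M N P Q : lmodType R.

Definition lin_of A C (f : A -> C) (H : linear f) : {linear A -> C} :=
  HB.pack f (GRing.isLinear.Build R A C _ f H).

Lemma lin0 A C (f : {linear A -> C}) : f 0 = 0.
Proof. exact: raddf0. Qed.

Lemma linD A C (f : {linear A -> C}) x y : f (x + y) = f x + f y.
Proof. exact: raddfD. Qed.

Lemma linB A C (f : {linear A -> C}) x y : f (x - y) = f x - f y.
Proof. exact: raddfB. Qed.

Lemma linN A C (f : {linear A -> C}) x : f (- x) = - f x.
Proof. exact: raddfN. Qed.

Lemma lin_inj A C (f : {linear A -> C}) :
  (forall x, f x = 0 -> x = 0) -> injective f.
Proof.
move=> f0 x y e; apply/eqP; rewrite -subr_eq0; apply/eqP/f0.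
by rewrite linB e subrr.
Qed.

Definition surj A C (p : A -> C) := forall y, exists x, p x = y.

(** A choice [r] of preimages under [s] need not be linear, but [f \o r] is, since [f] agrees on
    elements with the same image under [s]. *)
Lemma factor_surj A C E (s : {linear A -> C}) (f : {linear A -> E}) :
  surj s -> (forall x, s x = 0 -> f x = 0) ->
  exists g : {linear C -> E}, forall x, g (s x) = f x.
Proof.
move=> /choice[r rK] sf.
have fE x y : s x = s y -> f x = f y.
  by move=> e; apply/eqP; rewrite -subr_eq0 -linB sf// linB e subrr.
have L : linear (f \o r).
  by move=> a x y; rewrite /= -linearP; apply: fE; rewrite linearP !rK.
by exists (lin_of L) => x; apply: fE; rewrite rK.
Qed.

Lemma factor_inj A C E (i : {linear A -> C}) (f : {linear E -> C}) :
  (forall x, i x = 0 -> x = 0) -> (forall x, exists y, i y = f x) ->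
  exists g : {linear E -> A}, forall x, i (g x) = f x.
Proof.
move=> i0 /choice[r rK].
have iI x y : i x = i y -> x = y.
  by move=> e; apply/eqP; rewrite -subr_eq0; apply/eqP/i0; rewrite linB e subrr.
have L : linear r by move=> a x y; apply: iI; rewrite linearP !rK linearP.
by exists (lin_of L).
Qed.

Lemma bij_mod_iso A C (f : {linear A -> C}) :
  (forall x, f x = 0 -> x = 0) -> surj f -> mod_iso A C.
Proof.
move=> f0 fS.
have [//|g gK] := @factor_inj A C C f idfun f0.
exists f, g; split=> // x.
by apply/eqP; rewrite -subr_eq0; apply/eqP/f0; rewrite linB gK subrr.
Qed.

Lemma mod_iso_refl A : mod_iso A A.
Proof. by exists idfun, idfun. Qed.

Lemma mod_iso_sym A C : mod_iso A C -> mod_iso C A.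
Proof. by move=> [f [g [fK gK]]]; exists g, f. Qed.

Lemma mod_iso_trans A C E : mod_iso A C -> mod_iso C E -> mod_iso A E.
Proof.
move=> [f [g [fK gK]]] [f' [g' [fK' gK']]].
by exists (f' \o f), (g \o g'); split=> x; rewrite /= ?fK' ?gK.
Qed.

Lemma gorenstein_projective_iso A C :
  mod_iso A C -> gorenstein_projective C -> gorenstein_projective A.
Proof.
move=> AC [P [f [? ? CK ?]]]; exists P, f; split=> //.
exact: mod_iso_trans AC CK.
Qed.

Definition incl A (S : submodClosed A) : {linear submod S -> A} := val.

Lemma incl_inj0 A (S : submodClosed A) (x : submod S) : incl S x = 0 -> x = 0.
Proof. by move=> x0; apply: val_inj. Qed.

Lemma mod_iso_ker A P Q (u : {linear A -> P}) (g : {linear P -> Q}) :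
  (forall x, u x = 0 -> x = 0) -> exact_at u g -> mod_iso A (submod (ker_mod g)).
Proof.
move=> u0 ex.
have kP x : u x \in ker_mod g.
  by rewrite unfold_in; apply/eqP/ex; exists x.
have L : linear (fun x => Submod (kP x)).
  by move=> a x y; apply: val_inj; rewrite /= linearP.
apply: (@bij_mod_iso _ _ (lin_of L)) => [x [/u0//]|[y yk]].
have [x xy] : exists x, u x = y by apply/ex/eqP.
by exists x; apply: val_inj.
Qed.

(** * Short exact sequences and splicing *)

Definition ses A E C (i : {linear A -> E}) (p : {linear E -> C}) :=
  [/\ forall x, i x = 0 -> x = 0, exact_at i p & surj p].

Lemma exact_corestriction (M : int -> lmodType R)
    (f : forall i, {linear M i -> M (i + 1)}) i : exact_seq f ->
  exists p : {linear M i -> submod (ker_mod (f (i + 1)))},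
    forall x, val (p x) = f i x.
Proof.
move=> fE; apply: (@factor_inj _ _ _ (incl _)) => [x|x]; first exact: incl_inj0.
have kx : f i x \in ker_mod (f (i + 1)).
  by rewrite unfold_in; apply/eqP/fE; exists x.
by exists (Submod kx).
Qed.

Lemma exact_corestriction_ses (M : int -> lmodType R)
    (f : forall i, {linear M i -> M (i + 1)}) i
    (p : {linear M i -> submod (ker_mod (f (i + 1)))}) : exact_seq f ->
  (forall x, val (p x) = f i x) -> ses (incl (ker_mod (f i))) p.
Proof.
move=> fE pE; split=> [x|x|y]; first exact: incl_inj0.
  split=> [px|[y <-]].
    have kx : x \in ker_mod (f i) by rewrite unfold_in -pE px.
    by exists (Submod kx).
  by apply: val_inj; rewrite pE; case: y => z /= /eqP.
have [x xE] : exists x, f i x = val y by apply/fE/eqP; case: y.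
by exists x; apply: val_inj; rewrite -xE -pE.
Qed.

(** Since [iota] is injective and [pi] surjective, the kernel of [f (i + 1)] and the image of [f i]
    both equal the image of [iota (i + 1)]. *)
Lemma splice_exact (K P : int -> lmodType R) (iota : forall i, {linear K i -> P i})
    (pi : forall i, {linear P i -> K (i + 1)})
    (f : forall i, {linear P i -> P (i + 1)}) :
  (forall i, ses (iota i) (pi i)) ->
  (forall i x, f i x = iota (i + 1) (pi i x)) -> exact_seq f.
Proof.
move=> ip fE i y; rewrite fE.
have [_ _ pS] := ip i; have [_ ex _] := ip (i + 1); have [j0 _ _] := ip (i + 1 + 1).
split=> [/j0/ex[z <-]|[x <-]]; first by have [x <-] := pS z; exists x; rewrite fE.
rewrite fE; have -> : pi (i + 1) (iota (i + 1) (pi i x)) = 0; last exact: lin0.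
by apply/ex; exists (pi i x).
Qed.

Lemma ses_coker_iso A P C C' (i : {linear A -> P}) (p : {linear P -> C})
    (p' : {linear P -> C'}) : ses i p -> ses i p' -> mod_iso C C'.
Proof.
move=> [_ ex pS] [_ ex' pS'].
have [x /ex[y <-]|g gE] := factor_surj (f := p') pS; first by apply/ex'; exists y.
apply: (bij_mod_iso (f := g)).
  move=> x; have [y <-] := pS x; rewrite gE => /ex'[z <-].
  by apply/ex; exists z.
by move=> y; have [x <-] := pS' y; exists (p x).
Qed.

(** * Projective modules, splittings and extensions *)

Lemma projective_retract C P (u : {linear C -> P}) (v : {linear P -> C}) :
  cancel u v -> projective P -> projective C.
Proof.
move=> uK Pp M N g f gS.
have [h hE] := Pp M N g (f \o v) gS.
by exists (h \o u) => x; rewrite /= hE /= uK.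
Qed.

Lemma projective_prod P Q : projective P -> projective Q ->
  projective (P * Q)%type.
Proof.
move=> Pp Qp M N g f gS.
have L1 : linear (fun x : P => f (x, 0)).
  by move=> a x y; rewrite -linearP; congr (f (_, _)); rewrite /= scaler0 addr0.
have L2 : linear (fun x : Q => f (0, x)).
  by move=> a x y; rewrite -linearP; congr (f (_, _)); rewrite /= scaler0 addr0.
have [h1 h1E] := Pp M N g (lin_of L1) gS.
have [h2 h2E] := Qp M N g (lin_of L2) gS.
exists ((h1 \o fst) \+ (h2 \o snd)) => -[x y].
by rewrite /= linD/= h1E h2E /= -linD; congr (f (_, _)); rewrite /= ?addr0 ?add0r.
Qed.

Lemma ses_section A E C (i : {linear A -> E}) (p : {linear E -> C}) :
  ses i p -> projective C -> exists s : {linear C -> E}, cancel s p.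
Proof. by move=> [_ _ pS] Cp; exact: (Cp _ _ p idfun pS). Qed.

Lemma ses_retraction A E C (i : {linear A -> E}) (p : {linear E -> C}) :
  ses i p -> projective C -> exists r : {linear E -> A}, cancel i r.
Proof.
move=> ip Cp; have [s sK] := ses_section ip Cp; have [i0 ex pS] := ip.
have [x|r rE] := @factor_inj _ _ _ i (idfun \- (s \o p)) i0.
  by apply/ex; rewrite /= linB/= sK subrr.
exists r => x; apply/eqP; rewrite -subr_eq0; apply/eqP/i0.
have -> : i (r (i x) - x) = i (r (i x)) - i x by rewrite linB.
have /= -> := rE (i x); have -> : p (i x) = 0 by apply/ex; exists x.
by rewrite lin0 subr0 subrr.
Qed.

(* [Ext^1(C, Q) = 0] for every projective [Q], in terms of extensions. *)
Definition ext1_vanishes C := forall A E Q (i : {linear A -> E})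
  (p : {linear E -> C}) (phi : {linear A -> Q}), ses i p -> projective Q ->
  exists psi : {linear E -> Q}, forall x, psi (i x) = phi x.

Lemma projective_ext1 C : projective C -> ext1_vanishes C.
Proof.
move=> Cp A E Q i p phi ip _; have [r rK] := ses_retraction ip Cp.
by exists (phi \o r) => x; rewrite /= rK.
Qed.

(** Vanishing of [Ext^1] extends the identity of [A] to a retraction [r] of [i]. Then
    [idfun \- (i \o r)] kills the image of [i] and descends to a section of [p], so [C] is a retract
    of [E]. *)
Lemma ses_projective A E C (i : {linear A -> E}) (p : {linear E -> C}) :
  ses i p -> projective A -> ext1_vanishes C -> projective E -> projective C.
Proof.
move=> ip Ap Cx; have [r rK] := Cx _ _ _ i p idfun ip Ap.
have [i0 ex pS] := ip.
have [x /ex[y <-]|s sE] := factor_surj (f := idfun \- (i \o r)) pS.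
  by rewrite /= rK subrr.
apply: (@projective_retract _ _ s p) => x; have [y <-] := pS x.
have /= -> := sE y; rewrite linB/=.
by have -> : p (i (r y)) = 0; [apply/ex; exists (r y)|rewrite subr0].
Qed.

(** The map [phi] is extended in two stages: first to [K], the kernel of [p \o q], which is an
    extension of [H] by [A], then from [K] to [E], where the quotient is [B]. *)
Lemma ext1_vanishes_ses H C B (i : {linear H -> C}) (p : {linear C -> B}) :
  ses i p -> ext1_vanishes H -> ext1_vanishes B -> ext1_vanishes C.
Proof.
move=> [i0 ex pS] Hx Bx A E Q j q phi [j0 ex' qS] Qp.
pose K : lmodType R := submod (ker_mod (p \o q)).
pose v : {linear K -> E} := incl (ker_mod (p \o q)).
have pq x : p (q x) = 0 -> exists k : K, val k = x.
  move=> e; have kx : x \in ker_mod (p \o q) by rewrite unfold_in; apply/eqP.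
  by exists (Submod kx).
have [x|j' j'E] := factor_inj (f := j) (@incl_inj0 _ (ker_mod (p \o q))).
  by apply: pq; have -> : q (j x) = 0 by [apply/ex'; exists x]; rewrite lin0.
have [x|q' q'E] := @factor_inj _ _ _ i (q \o v) i0.
  by apply/ex; case: x => x /= /eqP.
have s1 : ses j' q'.
  split=> [x e|x|y].
  - by apply: j0; rewrite -j'E e.
  - split=> [e|[y <-]].
      have /ex'[y yE] : q (val x) = 0 by rewrite -[LHS]q'E e lin0.
      by exists y; apply: val_inj; rewrite -yE -j'E.
    apply: i0; rewrite q'E /= [val _]j'E; apply/ex'; by exists y.
  have [x xE] := qS (i y).
  have [|k kx] := pq x; first by rewrite xE; apply/ex; exists y.
  exists k; apply/eqP; rewrite -subr_eq0; apply/eqP/i0.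
  by rewrite linB q'E /= kx xE subrr.
have [phi1 phi1E] := Hx _ _ _ _ _ phi s1 Qp.
have s2 : ses v (p \o q).
  split=> [x /incl_inj0//|x|y].
    split=> [/pq[k <-]|[k <-]]; first by exists k.
    by case: k => k /= /eqP.
  by have [x <-] := pS y; have [z <-] := qS x; exists z.
have [psi psiE] := Bx _ _ _ _ _ phi1 s2 Qp.
by exists psi => x; rewrite -j'E psiE phi1E.
Qed.

(* [M'] is a cosyzygy of [M]; a module is Gorenstein projective iff it is a
   term of a chain of such steps that is infinite in both directions. *)
Definition gp_step M M' := exists P (i : {linear M -> P}) (p : {linear P -> M'}),
  [/\ projective P, ses i p & forall Q, projective Q ->
      forall phi : {linear M -> Q}, exists psi : {linear P -> Q},
      forall x, psi (i x) = phi x].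

Lemma gp_step_iso M M' N N' :
  mod_iso N M -> mod_iso N' M' -> gp_step M M' -> gp_step N N'.
Proof.
move=> [u [v [uK vK]]] [u' [v' [uK' vK']]] [P [i [p [Pp [i0 ex pS] iX]]]].
exists P, (i \o u), (v' \o p); split=> // [|Q Qp phi].
  split=> [x /= /i0 ux|x|y].
  - by rewrite -[x]uK ux lin0.
  - split=> [/= /(congr1 u')|[y <-] /=].
      rewrite vK' lin0 => /ex[y <-]; exists (v y); by rewrite /= vK.
    by have -> : p (i (u y)) = 0; [apply/ex; exists (u y)|rewrite lin0].
  - by have [x xE] := pS (u' y); exists x; rewrite /= xE uK'.
have [psi psiE] := iX Q Qp (phi \o v).
by exists psi => x; rewrite /= psiE /= uK.
Qed.

(** The cover [q] lifts to [l : P -> E], which restricts to [rho : M' -> A]. This presents [E] as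
    the pushout of [A] and [P] over [M']; extending [phi \o rho] to [h] on [P] makes [phi] and [h]
    glue to a map on [E]. *)
Lemma gp_step_ext1 M' M : gp_step M' M -> ext1_vanishes M.
Proof.
move=> [P [j [q [Pp [j0 exj qS] jX]]]] A E Q i p phi [i0 ex pS] Qp.
have [l lE] := Pp _ _ p q pS.
have [x|rho rhoE] := @factor_inj _ _ _ i (l \o j) i0.
  by apply/ex; rewrite /= lE; apply/exj; exists x.
have [h hE] := jX Q Qp (phi \o rho).
have sS : surj ((i \o fst) \+ (l \o snd) : (A * P)%type -> E).
  move=> e; have [x xE] := qS (p e).
  have [a aE] : exists a, i a = e - l x by apply/ex; rewrite linB lE xE subrr.
  by exists (a, x); rewrite /= aE subrK.
have [[a x] /= e|g gE] := factor_surj (f := (phi \o fst) \+ (h \o snd)) sS.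
  have [y yE] : exists y, j y = x.
    apply/exj; rewrite -lE -[l x]add0r -(subrr (i a)) addrAC e sub0r linN.
    by have -> : p (i a) = 0; [apply/ex; exists a|rewrite oppr0].
  have -> : a = - rho y.
    apply/eqP; rewrite -subr_eq0 opprK; apply/eqP/i0.
    by rewrite linD rhoE /= yE.
  by rewrite -yE hE /= linN addNr.
exists g => x; have := gE (x, 0); rewrite /= !lin0 !addr0; exact.
Qed.

(** * Gorenstein projective modules as two-sided chains of steps *)

Lemma dep_choice (I : Type) (T : I -> Type) (rel : forall i, T i -> Prop) :
  (forall i, exists x, rel i x) -> exists t : forall i, T i, forall i, rel i (t i).
Proof.
by move=> ex; exists (fun i => sval (cid (ex i))) => i; case: cid.
Qed.

Lemma int_chain (T : Type) (rel : T -> T -> Prop) (x0 : T) :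
  (forall x, exists y, rel x y) -> (forall y, exists x, rel x y) ->
  exists t : int -> T, t 0 = x0 /\ forall i, rel (t i) (t (i + 1)).
Proof.
move=> /choice[u uE] /choice[v vE].
(* [Negz n] is [-(n + 1)], hence [n.+1] backward steps from [x0]. *)
exists (fun i => match i with Posz n => iter n u x0 | Negz n => iter n.+1 v x0 end).
split=> // -[n|[|n]].
- by rewrite -PoszD addn1; apply: uE.
- exact: vE.
- have -> : Negz n.+1 + 1 = Negz n by rewrite !NegzE -[n.+2]addn1 PoszD opprD subrK.
  exact: vE.
Qed.

(** A coinduction principle: steps chosen inside [S] in both directions form a chain through [M],
    and splicing its short exact sequences gives a complete resolution. *)
Lemma gp_coind (S : lmodType R -> Prop) M :
  (forall N, S N -> exists2 N', S N' & gp_step N N') ->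
  (forall N, S N -> exists2 N', S N' & gp_step N' N) ->
  S M -> gorenstein_projective M.
Proof.
move=> up dn SM; pose T := {N | S N}.
pose rel (x y : T) := gp_step (sval x) (sval y).
have [||t [t0 tE]] := @int_chain T rel (exist _ _ SM).
- by move=> [N SN]; have [N' SN' st] := up N SN; exists (exist _ _ SN').
- by move=> [N SN]; have [N' SN' st] := dn N SN; exists (exist _ _ SN').
have {}t0 : sval (t 0) = M by rewrite t0.
pose K i := sval (t i).
have [P {}tE] := dep_choice tE.
have [iota {}tE] := dep_choice tE.
have [p {}tE] := dep_choice tE.
have pi0 i x : p i (iota i x) = 0.
  by have [_ [_ ex _] _] := tE i; apply/ex; exists x.
exists P, (fun i => iota (i + 1) \o p i); split.
- by move=> i; have [] := tE i.
- by apply: (splice_exact (iota := iota) (pi := p)) => // i; have [] := tE i.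
- rewrite -t0; have [_ [j0 ex _] _] := tE 0; have [_ [i0 _ _] _] := tE (0 + 1).
  apply: (mod_iso_ker (u := iota 0)) => // y.
  by split=> [/= /i0/ex|/ex /= ->]; rewrite ?lin0.
- move=> Q Qp i g; have [_ [_ _ pS] _] := tE i.
  have [_ [_ ex pS'] _] := tE (i + 1); have [_ _ iX] := tE (i + 1 + 1).
  split=> [g0|[h hE] x]; last by rewrite -hE /= pi0 !lin0.
  (* The map [g] kills the image of [iota (i + 1)], so it descends to [K (i + 1 + 1)] and from there
     extends along the next [iota]. *)
  have [y|k kE] := factor_surj (f := g) pS'.
    by move=> /ex[z <-]; have [x <-] := pS z; apply: g0.
  by have [h hE] := iX Q Qp k; exists h => y /=; rewrite hE kE.
Qed.

(** The class consists of all modules isomorphic to a kernel in one fixed complete resolution of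
    [M]. *)
Lemma gorenstein_class M : gorenstein_projective M ->
  exists S : lmodType R -> Prop,
  [/\ forall N, S N -> exists2 N', S N' & gp_step N N',
      forall N, S N -> exists2 N', S N' & gp_step N' N & S M].
Proof.
move=> [P [f [Pp fE MK fX]]]; pose K i : lmodType R := submod (ker_mod (f i)).
(* The shift by two leaves room for [P i] and [P (i + 1)]: a map on [K (i + 1 + 1)] extends to
   [P (i + 1 + 1)] because its composite with [p] vanishes on the image of [f i]. *)
have st i : gp_step (K (i + 1 + 1)) (K (i + 1 + 1 + 1)).
  have [p pE] := exact_corestriction (i + 1) fE.
  have [q qE] := exact_corestriction (i + 1 + 1) fE.
  exists (P (i + 1 + 1)), (incl _), q; split=> //.
    exact: exact_corestriction_ses.
  move=> Q Qp phi; have [_ _ pS] := exact_corestriction_ses fE pE.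
  have [|h hE] := (fX Q Qp i (phi \o p)).1.
    move=> x /=; have -> : p (f i x) = 0; last exact: lin0.
    by apply: val_inj; rewrite pE; apply/fE; exists x.
  by exists h => x; have [y <-] := pS x; rewrite -[RHS]hE -pE.
exists (fun N => exists i, mod_iso N (K i)); split; last by exists 0.
- move=> N [i NK]; exists (K (i + 1)); first by exists (i + 1); exact: mod_iso_refl.
  by have := st (i - 1 - 1); rewrite !subrK; exact: gp_step_iso NK (mod_iso_refl _).
- move=> N [i NK]; exists (K (i - 1)); first by exists (i - 1); exact: mod_iso_refl.
  by have := st (i - 1 - 1 - 1); rewrite !subrK; exact: gp_step_iso (mod_iso_refl _) NK.
Qed.

Lemma gorenstein_projective_up M : gorenstein_projective M ->
  exists2 M', gorenstein_projective M' & gp_step M M'.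
Proof.
move=> /gorenstein_class[S [up dn SM]]; have [M' SM' st] := up M SM.
by exists M' => //; apply: gp_coind up dn SM'.
Qed.

Lemma gorenstein_projective_down M : gorenstein_projective M ->
  exists2 M', gorenstein_projective M' & gp_step M' M.
Proof.
move=> /gorenstein_class[S [up dn SM]]; have [M' SM' st] := dn M SM.
by exists M' => //; apply: gp_coind up dn SM'.
Qed.

Lemma gorenstein_projective_ext1 M : gorenstein_projective M -> ext1_vanishes M.
Proof. by move=> /gorenstein_projective_down[M' _ /gp_step_ext1]. Qed.

End Modules.

(** * Cycles, boundaries and homology *)

Section Complexes.
Variable R : pzRingType.
Implicit Types (M N : lmodType R) (C G : complex R).

Lemma quot_pi0 M (S : submodClosed M) (x : M) : quot_pi S x = 0 <-> x \in S.
Proof.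
rewrite -(lin0 (quot_pi S : {linear M -> quotmod S})).
by split=> [/eqP|xS]; [|apply/eqP]; rewrite quot_piE subr0.
Qed.

Lemma quot_piB M (S : submodClosed M) : {morph quot_pi S : x y / x - y}.
Proof. exact: raddfB. Qed.

Lemma quot_pi_surj M (S : submodClosed M) : surj (quot_pi S).
Proof. by move=> q; exists (quot_repr q); rewrite quot_reprK. Qed.

(** This is the proof term inside [cycles], so membership in [cycles] unfolds to it by
    conversion. *)
Definition predK (n : int) : n = n - 1 + 1 := esym (subrK 1 n).

Lemma cyclesP C m n (e : m = n + 1) (x : C m) :
  x \in cycles C m <-> cdiff C e x = 0.
Proof.
(* Once [n] is replaced by [m - 1], the proof [e] has the type of [predK m], and equality proofs on
   [int] are unique. *)
have En : n = m - 1 by rewrite e addrK.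
subst n; rewrite (eq_irrelevance e (predK m)).
by split=> [/eqP|/eqP].
Qed.

Lemma boundariesP C m n (e : m = n + 1) (y : C n) :
  y \in boundaries C n <-> exists x, cdiff C e x = y.
Proof. by subst m; split=> /asboolP. Qed.

Lemma cdiff_boundaries C m n (e : m = n + 1) (x : C m) :
  cdiff C e x \in boundaries C n.
Proof. by apply/(boundariesP e); exists x. Qed.

Lemma boundaries_cycles C n (x : C n) : x \in boundaries C n -> x \in cycles C n.
Proof.
move=> /(boundariesP erefl)[y <-]; apply/(cyclesP (predK n)); exact: cdiffK.
Qed.

Fact diffB_exists C m n (e : m = n + 1) :
  {f : {linear C m -> Bmod C n} | forall x, val (f x) = cdiff C e x}.
Proof.
have L : linear (fun x : C m => Submod (cdiff_boundaries e x)).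
  by move=> a x y; apply: val_inj; rewrite /= linearP.
by exists (lin_of L).
Qed.

(* Defined through an opaque existence statement so that simplification does
   not expose the underlying function. *)
Definition diffB C m n (e : m = n + 1) : {linear C m -> Bmod C n} :=
  sval (diffB_exists C e).

Lemma val_diffB C m n (e : m = n + 1) (x : C m) :
  val (diffB C e x) = cdiff C e x.
Proof. exact: (svalP (diffB_exists C e)). Qed.

Lemma diffB_surj C m n (e : m = n + 1) : surj (diffB C e).
Proof.
move=> [y yB]; have /(boundariesP e)[x xE] := yB.
by exists x; apply: val_inj; rewrite val_diffB.
Qed.

Lemma diffB0 C m n (e : m = n + 1) (x : C m) :
  diffB C e x = 0 <-> x \in cycles C m.
Proof.
rewrite (cyclesP e); split=> [/(congr1 val)|x0]; first by rewrite val_diffB.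
by apply: val_inj; rewrite val_diffB.
Qed.

Lemma cycles_ses C m n (e : m = n + 1) : ses (incl (cycles C m)) (diffB C e).
Proof.
split=> [x|x|]; [exact: incl_inj0| |exact: diffB_surj].
by rewrite diffB0; split=> [xS|[y <-]]; [exists (Submod xS)|case: y].
Qed.

(** Opaque for the same reason as [diffB]. *)
Fact ZtoH_exists C n : {f : {linear Zmod C n -> Hmod C n} |
  forall z, f z = quot_pi (sub_in (cycles C n) (boundaries C n)) z}.
Proof. by exists (quot_pi (sub_in (cycles C n) (boundaries C n))). Qed.

Definition ZtoH C n : {linear Zmod C n -> Hmod C n} := sval (ZtoH_exists C n).

Lemma ZtoHE C n z : ZtoH C n z = quot_pi (sub_in (cycles C n) (boundaries C n)) z.
Proof. exact: (svalP (ZtoH_exists C n)). Qed.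

Lemma ZtoH0 C n (z : Zmod C n) : ZtoH C n z = 0 <-> val z \in boundaries C n.
Proof. by rewrite ZtoHE quot_pi0. Qed.

Lemma ZtoH_surj C n : surj (ZtoH C n).
Proof. by move=> q; have [x <-] := quot_pi_surj q; exists x; rewrite ZtoHE. Qed.

Fact toCmodB_exists C n :
  {f : {linear C n -> CmodB C n} | forall x, f x = quot_pi (boundaries C n) x}.
Proof. by exists (quot_pi (boundaries C n)). Qed.

Definition toCmodB C n : {linear C n -> CmodB C n} := sval (toCmodB_exists C n).

Lemma toCmodBE C n x : toCmodB C n x = quot_pi (boundaries C n) x.
Proof. exact: (svalP (toCmodB_exists C n)). Qed.

Lemma toCmodB0 C n (x : C n) : toCmodB C n x = 0 <-> x \in boundaries C n.
Proof. by rewrite toCmodBE quot_pi0. Qed.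

Lemma toCmodB_surj C n : surj (toCmodB C n).
Proof. by move=> q; have [x <-] := quot_pi_surj q; exists x; rewrite toCmodBE. Qed.

Lemma CmodB_pi_ses C n : ses (incl (boundaries C n)) (toCmodB C n).
Proof.
split=> [x|x|]; [exact: incl_inj0| |exact: toCmodB_surj].
by rewrite toCmodB0; split=> [xB|[y <-]]; [exists (Submod xB)|case: y].
Qed.

(** The differential vanishes on boundaries, so it descends to [C_m / B_m]; its image is [B_n] and
    its kernel is [Z_m / B_m]. *)
Lemma CmodB_ses C m n (e : m = n + 1) :
  exists (i : {linear Hmod C m -> CmodB C m}) (p : {linear CmodB C m -> Bmod C n}),
  [/\ ses i p, forall z, i (ZtoH C m z) = toCmodB C m (val z)
    & forall x, p (toCmodB C m x) = diffB C e x].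
Proof.
have [z|i iE] := factor_surj (f := toCmodB C m \o incl (cycles C m)) (@ZtoH_surj C m).
  by move=> /ZtoH0 zB; apply/toCmodB0.
have [x|p pE] := factor_surj (f := diffB C e) (@toCmodB_surj C m).
  by move=> /toCmodB0 xB; apply/diffB0; exact: boundaries_cycles.
exists i, p; split=> //; split=> [h|x|y].
- have [z <-] := ZtoH_surj h; rewrite iE => /toCmodB0 zB.
  exact/ZtoH0.
- have [y <-] := toCmodB_surj x; rewrite pE diffB0; split=> [yZ|[h]].
    by exists (ZtoH C m (Submod yZ)); rewrite iE.
  have [z <-] := ZtoH_surj h; rewrite iE /= => /eqP.
  rewrite -subr_eq0 -linB => /eqP/toCmodB0/boundaries_cycles zy.
  rewrite -[y]opprK -[- y](addKr (val z)) opprD opprK; apply: rpredB => //.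
  by case: (z).
- by have [x <-] := diffB_surj e y; exists (toCmodB C m x); rewrite pE.
Qed.

Lemma CmodB_ext1 C m n (e : m = n + 1) : ext1_vanishes (Hmod C m) ->
  ext1_vanishes (Bmod C n) -> ext1_vanishes (CmodB C m).
Proof. by have [i [p [ip _ _]]] := CmodB_ses C e; exact: ext1_vanishes_ses ip. Qed.


(** A splitting of [Q] into discs and spheres: the three summands are a boundary, a cycle depending
    only on the class modulo boundaries, and a lift of the differential. Maps into [Q] can then be
    extended summand by summand. *)
Lemma CE_projective_split (Q : complex R) m n (e : m = n + 1) : CE_projective Q ->
  exists (r : {linear Q m -> Bmod Q m}) (t : {linear CmodB Q m -> Zmod Q m})
    (s : {linear Bmod Q n -> Q m}),
  [/\ forall b, r (val b) = b, forall b, diffB Q e (s b) = b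
    & forall q, q = val (r q) + val (t (toCmodB Q m q)) + s (diffB Q e q)].
Proof.
move=> Qp; have [_ _ Bm Hm] := Qp m; have [_ _ Bn _] := Qp n.
have [s sE] := ses_section (cycles_ses Q e) Bn.
have Cx := CmodB_ext1 e (projective_ext1 Hm) (projective_ext1 Bn).
have [r rE] := Cx _ _ _ _ _ idfun (CmodB_pi_ses Q m) Bm.
(* The remainder [u] has values in the cycles, because [s] splits the differential, and vanishes on
   boundaries, because [r] is a retraction; this yields [t]. *)
pose u : {linear Q m -> Q m} := idfun \- (incl _ \o r) \- (s \o diffB Q e).
have [x|z zE] := factor_inj (f := u) (@incl_inj0 _ _ (cycles Q m)).
  have uZ : u x \in cycles Q m.
    apply/(diffB0 e); rewrite /u /= !linB [diffB _ _ (s _)]sE.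
    have -> : diffB Q e (val (r x)) = 0; last by rewrite subr0 subrr.
    by apply/diffB0/boundaries_cycles; case: (r x).
  by exists (Submod uZ).
have [x /toCmodB0 xB|t tE] := factor_surj (f := z) (@toCmodB_surj Q m).
  apply: incl_inj0; rewrite zE /u /=.
  have /diffB0 -> := boundaries_cycles xB; rewrite lin0 subr0.
  by have /= -> := rE (Submod xB); rewrite subrr.
exists r, t, s; split=> // q.
have -> : val (t (toCmodB Q m q)) = u q by rewrite tE; exact: zE.
by rewrite /u /= addrA subrK addrC subrK.
Qed.


(** * Degreewise short exact sequences of complexes that are surjective on cycles *)

Section Step.
Variables (G P G' : complex R) (iota : chain_map G P) (pi : chain_map P G').
Hypothesis iota_pi : forall n, ses (iota n) (pi n).
Hypothesis cycles_lift : forall n z', z' \in cycles G' n ->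
  exists2 z, z \in cycles P n & pi n z = z'.

Lemma step_inj n x : iota n x = 0 -> x = 0.
Proof. by have [i0 _ _] := iota_pi n; exact: i0. Qed.

Lemma step_exact n x : pi n x = 0 -> exists g, iota n g = x.
Proof. by have [_ ex _] := iota_pi n; move=> /ex. Qed.

Lemma step_comp n x : pi n (iota n x) = 0.
Proof. by have [_ ex _] := iota_pi n; apply/ex; exists x. Qed.

Lemma step_surj n : surj (pi n).
Proof. by have [_ _ pS] := iota_pi n. Qed.

Lemma step_cycles n g : iota n g \in cycles P n -> g \in cycles G n.
Proof.
move=> /(cyclesP (predK n)); rewrite -cmapE => /step_inj g0.
exact/(cyclesP (predK n)).
Qed.

(** If [b] is the differential of [x], then [pi] sends [x] to a cycle. Subtracting a cycle [z] over
    it leaves the differential unchanged and moves [x] into the image of [iota]. *)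
Lemma step_boundaries n b : b \in boundaries P n -> pi n b = 0 ->
  exists2 g, g \in boundaries G n & iota n g = b.
Proof.
move=> /(boundariesP erefl)[x <-]; rewrite cmapE => /(cyclesP erefl)/cycles_lift.
move=> [z /(cyclesP erefl) z0 zx].
have [g gE] : exists g, iota (n + 1) g = x - z by apply: step_exact; rewrite linB zx subrr.
exists (cdiff G erefl g); first exact: cdiff_boundaries.
by rewrite cmapE gE linB z0 subr0.
Qed.

Lemma step_boundaries_surj n x : pi n x \in boundaries G' n ->
  exists2 b, b \in boundaries P n & pi n b = pi n x.
Proof.
move=> /(boundariesP erefl)[y' <-]; have [y <-] := step_surj y'.
by exists (cdiff P erefl y); rewrite ?cmapE//; exact: cdiff_boundaries.
Qed.

Lemma toCmodB_map C D (f : chain_map C D) n x :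
  CmodB_map f n (toCmodB C n x) = toCmodB D n (f n x).
Proof. by rewrite !toCmodBE; exact: quotmod_map_pi. Qed.

Lemma step_CmodB n : ses (CmodB_map iota n) (CmodB_map pi n).
Proof.
split=> [q|q|q].
- have [x <-] := toCmodB_surj q; rewrite toCmodB_map => /toCmodB0 xB.
  have [g gB /eqP] := step_boundaries xB (step_comp x).
  rewrite -subr_eq0 -linB => /eqP/step_inj/eqP; rewrite subr_eq0 => /eqP <-.
  exact/toCmodB0.
- have [x <-] := toCmodB_surj q; rewrite toCmodB_map.
  split=> [/toCmodB0/step_boundaries_surj[b bB bx]|[q' q'E]].
    have [g gE] : exists g, iota n g = x - b by apply: step_exact; rewrite linB bx subrr.
    exists (toCmodB _ n g); rewrite toCmodB_map gE linB.
    by have /toCmodB0 -> := bB; rewrite subr0.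
  have [g gE] := toCmodB_surj q'; rewrite -gE in q'E.
  by move: q'E; rewrite -toCmodB_map => <-; rewrite !toCmodB_map step_comp lin0.
- have [x <-] := toCmodB_surj q; have [y <-] := step_surj x.
  by exists (toCmodB _ n y); rewrite toCmodB_map.
Qed.

Lemma step_Z n : ses (Zmap iota n) (Zmap pi n).
Proof.
split=> [z /(congr1 val) /= /step_inj z0|z|z]; first exact: val_inj.
  split=> [/(congr1 val) /= /step_exact[g gz]|[y <-]].
    have gZ : g \in cycles G n by apply: step_cycles; rewrite gz submod_valP.
    by exists (Submod gZ); apply: val_inj.
  by apply: val_inj; exact: step_comp.
have [x xZ xz] := cycles_lift (submod_valP z).
by exists (Submod xZ); apply: val_inj.
Qed.

Lemma step_B n : ses (Bmap iota n) (Bmap pi n).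
Proof.
split=> [z /(congr1 val) /= /step_inj z0|z|z]; first exact: val_inj.
  split=> [/(congr1 val) /= /(step_boundaries (submod_valP z))[g gB gz]|[y <-]].
    by exists (Submod gB); apply: val_inj.
  by apply: val_inj; exact: step_comp.
have [x xz] := step_surj (val z).
have [|b bB bz] := @step_boundaries_surj n x; first by rewrite xz submod_valP.
by exists (Submod bB); apply: val_inj; rewrite /= bz.
Qed.

Lemma quot_CmodZ_map C D (f : chain_map C D) n x :
  CmodZ_map f n (quot_pi (cycles C n) x) = quot_pi (cycles D n) (f n x).
Proof. exact: quotmod_map_pi. Qed.

Lemma step_CmodZ n : ses (CmodZ_map iota n) (CmodZ_map pi n).
Proof.
split=> q; have [x <-] := quot_pi_surj q.
- by rewrite quot_CmodZ_map => /quot_pi0/step_cycles xZ; exact/quot_pi0.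
- rewrite quot_CmodZ_map; split=> [/quot_pi0/cycles_lift[z zZ zx]|[q' q'E]].
    have [g gE] : exists g, iota n g = x - z by apply: step_exact; rewrite linB zx subrr.
    exists (quot_pi _ g); rewrite quot_CmodZ_map gE quot_piB.
    by have /quot_pi0 -> := zZ; rewrite subr0.
  have [g gE] := quot_pi_surj q'; move: q'E; rewrite -gE -quot_CmodZ_map => <-.
  by rewrite !quot_CmodZ_map step_comp; apply/quot_pi0; exact: rpred0.
- by have [y <-] := step_surj x; exists (quot_pi _ y); rewrite quot_CmodZ_map.
Qed.

Lemma ZtoH_map C D (f : chain_map C D) n z :
  Hmap f n (ZtoH C n z) = ZtoH D n (Zmap f n z).
Proof. by rewrite !ZtoHE; exact: quotmod_map_pi. Qed.

Lemma step_H n : ses (Hmap iota n) (Hmap pi n).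
Proof.
split=> q; have [z <-] := ZtoH_surj q.
- rewrite ZtoH_map => /ZtoH0/step_boundaries-/(_ (step_comp _))[g gB].
  by move=> /(lin_inj (@step_inj n)) gz; apply/ZtoH0; rewrite -gz.
- rewrite ZtoH_map; split=> [/ZtoH0/step_boundaries_surj[b bB bz]|[q' q'E]].
    have [g gE] : exists g, iota n g = val z - b.
      by apply: step_exact; rewrite linB bz subrr.
    have gZ : g \in cycles G n.
      by apply: step_cycles; rewrite gE rpredB ?submod_valP ?boundaries_cycles.
    exists (ZtoH _ _ (Submod gZ)); rewrite ZtoH_map.
    suff /eqP : ZtoH P n (z - Zmap iota n (Submod gZ)) = 0.
      by rewrite linB subr_eq0 => /eqP.
    by apply/ZtoH0; rewrite /= gE subKr.
  have [g gE] := ZtoH_surj q'; move: q'E; rewrite -gE -ZtoH_map => <-.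
  rewrite !ZtoH_map; have -> : Zmap pi n (Zmap iota n g) = 0; last exact: lin0.
  by apply: val_inj; exact: step_comp.
- have [_ _ pS] := step_Z n; have [y <-] := pS z.
  by exists (ZtoH _ _ y); rewrite ZtoH_map.
Qed.

(** After splitting [Q], the component in the boundaries extends over [P n] because [G' n] is
    projective, and the component given by [t] extends over [CmodB P n] because [Ext^1] from
    [CmodB G' n] vanishes. *)
Lemma step_chain_ext (Q : complex R) (k : chain_map G Q) :
  (forall n, projective (G' n)) -> (forall n, ext1_vanishes (CmodB G' n)) ->
  CE_projective Q ->
  exists h : chain_map P Q, forall n x, h n (iota n x) = k n x.
Proof.
move=> G'p Cx Qp.
have [r rE] := dep_choice (fun n => CE_projective_split (predK n) Qp).
have [t {}rE] := dep_choice rE.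
have [s {}rE] := dep_choice rE.
have Ea n : exists a : {linear P n -> Bmod Q n},
    forall x, a (iota n x) = r n (k n x).
  have [_ _ Bp _] := Qp n.
  exact: (projective_ext1 (G'p n) (r n \o k n) (iota_pi n) Bp).
have [a aE] := dep_choice Ea.
have Eb n : exists b : {linear CmodB P n -> Zmod Q n},
    forall x, b (toCmodB P n (iota n x)) = t n (toCmodB Q n (k n x)).
  have [_ Zp _ _] := Qp n.
  have [b bE] := Cx n _ _ _ _ _ (t n \o CmodB_map k n) (step_CmodB n) Zp.
  by exists b => x; rewrite -toCmodB_map bE /= toCmodB_map.
have [b bE] := dep_choice Eb.
(* The last summand lifts the component [a] of degree [n - 1] through the differential of [Q], which
   makes [h] commute with the differentials. *)
pose h n : {linear P n -> Q n} := (incl _ \o a n) \+ (incl _ \o b n \o toCmodB P n)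
  \+ (s n \o a (n - 1) \o cdiff P (predK n)).
have hE m n (e : m = n + 1) (x : P m) : h n (cdiff P e x) = cdiff Q e (h m x).
  have En : n = m - 1 by rewrite e addrK.
  subst n; rewrite (eq_irrelevance e (predK m)) /h /= !linD cdiffK !lin0 addr0.
  have /toCmodB0 -> := cdiff_boundaries (predK m) x.
  rewrite !lin0 addr0.
  have /(cyclesP (predK m)) -> := boundaries_cycles (valP (a m x)).
  have /(cyclesP (predK m)) -> := valP (b m (toCmodB P m x)).
  rewrite !add0r.
  have [_ sE _] := rE m.
  by rewrite -[RHS]val_diffB sE.
exists (ChainMap hE) => n x; rewrite /= /h /= aE bE -cmapE aE.
have [rK _ kE] := rE n; rewrite [RHS]kE cmapE.
have [rK' _ _] := rE (n - 1).
by rewrite -[diffB _ _ _]rK' val_diffB.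
Qed.

End Step.
End Complexes.

(** * Sums of discs and spheres *)

Section Discs.
Variables (R : pzRingType) (PB PH : int -> lmodType R).

Definition transport (F : int -> lmodType R) m n (e : m = n) :
  {linear F m -> F n} := match e with erefl => idfun end.

Lemma transport_id (F : int -> lmodType R) n (e : n = n) x : transport F e x = x.
Proof. by rewrite (eq_irrelevance e erefl). Qed.

Definition disc_obj n : lmodType R := (PB n * PH n * PB (n - 1))%type.

Lemma predn_eq (m n : int) : m = n + 1 -> m - 1 = n.
Proof. by move=> ->; rewrite addrK. Qed.

Lemma disc_diff_linear m n (e : m = n + 1) :
  linear (fun x : disc_obj m => (transport PB (predn_eq e) x.2, 0, 0) : disc_obj n).
Proof.
by move=> a x y; rewrite linearP; congr (_, _, _); rewrite /= ?scaler0 ?addr0.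
Qed.

Definition disc_diff m n (e : m = n + 1) : {linear disc_obj m -> disc_obj n} :=
  lin_of (@disc_diff_linear m n e).

Lemma disc_diffK m n p (e : m = n + 1) (e' : n = p + 1) (x : disc_obj m) :
  disc_diff e' (disc_diff e x) = 0.
Proof. by rewrite /= lin0. Qed.

(* The direct sum of the complexes with [PH n] in degree [n], and of the
   complexes [PB n = PB n] in degrees [n + 1] and [n]. *)
Definition disc : complex R := Complex disc_diffK.

Lemma disc_diffE n (x : disc n) : cdiff disc (predK n) x = (x.2, 0, 0).
Proof. by congr (_, _, _); rewrite transport_id. Qed.

Lemma disc_cycles n (x : disc n) : x \in cycles disc n <-> x.2 = 0.
Proof.
rewrite (cyclesP (predK n)) disc_diffE; split=> [|->//].
by case.
Qed.

Lemma disc_boundaries n (x : disc n) : x \in boundaries disc n <-> x = (x.1.1, 0, 0).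
Proof.
rewrite (boundariesP erefl); split=> [[y <-]//|->].
(* The preimage carries [x.1.1] in its last slot, which has type [PB (n + 1 - 1)]. *)
have e : n = n + 1 - 1 by rewrite addrK.
by exists (0, 0, transport PB e x.1.1); congr (_, _, _); rewrite /=; move: (predn_eq _);
  case: _ / e => e'; rewrite !transport_id.
Qed.

(** In degree [n] the boundaries, cycles and homology are retracts of [PB n], of the product of
    [PB n] and [PH n], and of [PH n]. *)
Lemma disc_CE_projective :
  (forall n, projective (PB n)) -> (forall n, projective (PH n)) -> CE_projective disc.
Proof.
move=> Bp Hp n; have BHp := projective_prod (Bp n) (Hp n).
pose fB : {linear disc n -> PB n} := fst \o fst.
pose fH : {linear disc n -> PH n} := snd \o fst.
have LB : linear (fun b : PB n => (b, 0, 0) : disc n).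
  by move=> a x y; congr (_, _, _); rewrite /= ?scaler0 ?addr0.
have LH : linear (fun b : PH n => (0, b, 0) : disc n).
  by move=> a x y; congr (_, _, _); rewrite /= ?scaler0 ?addr0.
have LZ : linear (fun b : (PB n * PH n)%type => (b, 0) : disc n).
  by move=> a x y; congr (_, _); rewrite /= ?scaler0 ?addr0.
have Bp' : projective (Bmod disc n).
  have [b|g gE] := factor_inj (f := lin_of LB) (@incl_inj0 _ _ (boundaries disc n)).
    have bB : (b, 0, 0) \in boundaries disc n by apply/disc_boundaries.
    by exists (Submod bB).
  apply: (@projective_retract _ _ _ (fB \o incl _) g) => // x.
  by apply: val_inj; rewrite [LHS]gE /=; case: x => x /= /disc_boundaries ->.
have Zp' : projective (Zmod disc n).
  have [b|g gE] := factor_inj (f := lin_of LZ) (@incl_inj0 _ _ (cycles disc n)).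
    have bB : (b, 0) \in cycles disc n by apply/disc_cycles.
    by exists (Submod bB).
  apply: (@projective_retract _ _ _ (fst \o incl _) g) => // x.
  apply: val_inj; rewrite [LHS]gE /=; case: x => -[x y] xZ /=.
  by have /disc_cycles /= -> := xZ.
split=> //; first exact: projective_prod.
have [b|g gE] := factor_inj (f := lin_of LH) (@incl_inj0 _ _ (cycles disc n)).
  have bB : (0, b, 0) \in cycles disc n by apply/disc_cycles.
  by exists (Submod bB).
have [z /ZtoH0/disc_boundaries|f fE] := factor_surj (f := fH \o incl _) (@ZtoH_surj _ disc n).
  by rewrite /= => ->.
apply: (@projective_retract _ _ _ f (ZtoH _ _ \o g)) => // x.
have [z <-] := ZtoH_surj x; rewrite fE /=.
suff /eqP : ZtoH disc n (g (fH (incl _ z)) - z) = 0.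
  by rewrite linB subr_eq0 => /eqP.
apply/ZtoH0/disc_boundaries; rewrite [val _](linB (incl _)) [incl _ (g _)]gE /=.
have /disc_cycles := submod_valP z; case: (submod_val z) => -[u v] w /= ->.
by congr (_, _, _); rewrite /= ?subrr.
Qed.

End Discs.

(** * Cokernels, kernels and composition of chain maps *)

Section CokernelComplex.
Variables (R : pzRingType) (C D : complex R) (f : chain_map C D).

Definition cokerc_obj (n : int) : lmodType R := quotmod (im_mod (f n)).

Lemma cokerc_diff_subproof m n (e : m = n + 1) :
  {in im_mod (f m), forall x, cdiff D e x \in im_mod (f n)}.
Proof.
move=> _ /asboolP[y <-]; apply/asboolP; exists (cdiff C e y); exact: cmapE.
Qed.

Definition cokerc_diff m n (e : m = n + 1) : {linear cokerc_obj m -> cokerc_obj n} :=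
  quotmod_map (cokerc_diff_subproof e).

Lemma cokerc_diffK m n p (e : m = n + 1) (e' : n = p + 1) (x : cokerc_obj m) :
  cokerc_diff e' (cokerc_diff e x) = 0.
Proof.
have [y <-] := quot_pi_surj x.
by rewrite [cokerc_diff e _]quotmod_map_pi [LHS]quotmod_map_pi cdiffK lin0.
Qed.

Definition coker_complex : complex R := Complex cokerc_diffK.

Lemma coker_pi_cmapE m n (e : m = n + 1) (x : D m) :
  quot_pi (im_mod (f n)) (cdiff D e x) =
  cdiff coker_complex e (quot_pi (im_mod (f m)) x).
Proof. by rewrite [RHS]quotmod_map_pi. Qed.

Definition coker_pi : chain_map D coker_complex :=
  @ChainMap R D coker_complex (fun n => quot_pi (im_mod (f n))) coker_pi_cmapE.

Lemma coker_ses n : (forall x, f n x = 0 -> x = 0) -> ses (f n) (coker_pi n).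
Proof.
move=> f0; split=> // [x|]; last exact: quot_pi_surj.
by rewrite quot_pi0; split=> [/asboolP|?]; last apply/asboolP.
Qed.

End CokernelComplex.

Section KernelComplex.
Variables (R : pzRingType) (C D : complex R) (f : chain_map C D).

Definition ker_incl : chain_map (ker_complex f) C :=
  @ChainMap R (ker_complex f) C (fun n => incl (ker_mod (f n))) (fun _ _ _ _ => erefl).

Lemma ker_ses n : surj (f n) -> ses (ker_incl n) (f n).
Proof.
move=> fS; split=> // [x /incl_inj0//|x].
split=> [fx|[[y /= /eqP yk] <-//]].
have xk : x \in ker_mod (f n) by rewrite unfold_in fx.
by exists (Submod xk).
Qed.

End KernelComplex.

Section CompChainMap.
Variables (R : pzRingType) (C D E : complex R).
Variables (g : chain_map D E) (f : chain_map C D).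

Lemma comp_cmapE m n (e : m = n + 1) (x : C m) :
  g n (f n (cdiff C e x)) = cdiff E e (g m (f m x)).
Proof. by rewrite !cmapE. Qed.

Definition comp_chain_map : chain_map C E :=
  @ChainMap R C E (fun n => g n \o f n) comp_cmapE.

End CompChainMap.

(** * Resolving a complex *)

Section Resolution.
Variable R : pzRingType.
Implicit Types (M K P : lmodType R) (G : complex R).

Lemma gorenstein_projective_cover M : gorenstein_projective M ->
  exists K P (i : {linear K -> P}) (p : {linear P -> M}),
  [/\ gorenstein_projective K, projective P & ses i p].
Proof.
by move=> /gorenstein_projective_down[K Kg [P [i [p [Pp ip _]]]]]; exists K, P, i, p.
Qed.

Lemma gorenstein_projective_hull M : gorenstein_projective M ->
  exists (C : lmodType R) P (i : {linear M -> P}) (p : {linear P -> C}),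
  [/\ gorenstein_projective C, projective P & ses i p].
Proof.
by move=> /gorenstein_projective_up[K Kg [P [i [p [Pp ip _]]]]]; exists K, P, i, p.
Qed.

Definition resolvable G := forall n,
  [/\ projective (G n), gorenstein_projective (Bmod G n)
    & gorenstein_projective (Hmod G n)].

(* Surjectivity on cycles makes the induced sequences of [Z], [B], [C/Z], [C/B]
   and [H] short exact as well. *)
Definition complex_step G G' :=
  exists (P : complex R) (iota : chain_map G P) (pi : chain_map P G'),
  [/\ CE_projective P, forall n, ses (iota n) (pi n)
    & forall n z', z' \in cycles G' n -> exists2 z, z \in cycles P n & pi n z = z'].

(** The covers [pB] and [pH] are lifted to maps into [G']: [lH] lifts [pH] to cycles and [lB] lifts
    [pB] through the differential. The kernel of the resulting chain map has boundaries [KB] and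
    homology [KH]. *)
Lemma resolvable_down G' : resolvable G' -> exists2 G, resolvable G & complex_step G G'.
Proof.
move=> G'r.
have EB n := gorenstein_projective_cover (let: And3 _ b _ := G'r n in b).
have EH n := gorenstein_projective_cover (let: And3 _ _ b := G'r n in b).
have [KB {}EB] := dep_choice EB; have [PB {}EB] := dep_choice EB.
have [iB {}EB] := dep_choice EB; have [pB {}EB] := dep_choice EB.
have [KH {}EH] := dep_choice EH; have [PH {}EH] := dep_choice EH.
have [iH {}EH] := dep_choice EH; have [pH {}EH] := dep_choice EH.
have PBp n : projective (PB n) by have [] := EB n.
have PHp n : projective (PH n) by have [] := EH n.
have [lH lHE] := dep_choice (fun n => PHp n _ _ (ZtoH G' n) (pH n) (@ZtoH_surj _ G' n)).
have [lB lBE] := dep_choice (fun n => PBp (n - 1) _ _ (diffB G' (predK n))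
  (pB (n - 1)) (diffB_surj (predK n))).
pose P := disc PB PH.
pose f n : {linear P n -> G' n} := (incl _ \o pB n \o fst \o fst)
  \+ (incl _ \o lH n \o snd \o fst) \+ (lB n \o snd).
have fE n x : f n x = val (pB n x.1.1) + val (lH n x.1.2) + lB n x.2 by [].
have df n x : cdiff G' (predK n) (f n x) = val (pB (n - 1) x.2).
  rewrite fE !linD.
  have /(cyclesP (predK n)) -> := boundaries_cycles (submod_valP (pB n x.1.1)).
  have /(cyclesP (predK n)) -> := submod_valP (lH n x.1.2).
  by rewrite !add0r -val_diffB lBE.
have fC m n (e : m = n + 1) (x : P m) : f n (cdiff P e x) = cdiff G' e (f m x).
  have En : n = m - 1 by rewrite e addrK.
  by subst n; rewrite (eq_irrelevance e (predK m)) disc_diffE df fE !lin0 !addr0.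
pose pi := ChainMap fC.
(* First [lH n y] matches the homology class of [z']; the difference is a boundary, which [pB]
   covers. *)
have fZ n z' : z' \in cycles G' n -> exists2 z, z \in cycles P n & f n z = z'.
  move=> zZ; have [_ _ [_ _ pS]] := EH n; have [_ _ [_ _ pS']] := EB n.
  have [y yE] := pS (ZtoH G' n (Submod zZ)).
  have bB : z' - val (lH n y) \in boundaries G' n.
    have /ZtoH0 : ZtoH G' n (Submod zZ - lH n y) = 0 by rewrite linB lHE yE subrr.
    by [].
  have [a aE] := pS' (Submod bB).
  exists (a, y, 0); first exact/disc_cycles.
  by rewrite fE /= aE lin0 addr0 /= subrK.
(* The last slot matches the differential of [x], and what remains is a cycle, covered by [fZ]. *)
have fS n : surj (pi n).
  move=> x; have [_ _ [_ _ pS]] := EB (n - 1).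
  have [c cE] := pS (diffB G' (predK n) x).
  have [|z _ zE] := fZ n (x - lB n c).
    by apply/(diffB0 (predK n)); rewrite linB lBE cE subrr.
  by exists (z + (0, 0, c)); rewrite linD [pi n z]zE [pi n _]fE !lin0 !add0r subrK.
have sesk n := ker_ses (fS n).
exists (ker_complex pi); last first.
  by exists P, (ker_incl pi), pi; split=> //; exact: disc_CE_projective.
move=> n; have [G'p _ _] := G'r n; split.
- have [r rK] := ses_retraction (sesk n) G'p.
  apply: projective_retract rK _.
  by have [] := disc_CE_projective PBp PHp n.
(* A boundary of the kernel has the form [(a, 0, 0)] in [P] with [pB n a = 0], so [a] comes from
   [KB n]; conversely [step_boundaries] applies to such elements. *)
- have [KBg _ [i0 ex _]] := EB n.
  have iBd (b : Bmod (ker_complex pi) n) : ker_incl pi n (val b) \in boundaries P n.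
    exact: boundaries_map (submod_valP b).
  have [b|g gE] := factor_inj
    (f := fst \o fst \o ker_incl pi n \o incl (boundaries (ker_complex pi) n)) i0.
    apply/ex; apply: incl_inj0.
    have : pi n (ker_incl pi n (val b)) = 0 by exact: step_comp sesk _ _.
    by have /disc_boundaries {1}-> := iBd b; rewrite [pi n _]fE !lin0 !addr0.
  apply: gorenstein_projective_iso KBg; apply: (bij_mod_iso (f := g)) => [b g0|k].
    apply: incl_inj0; apply: (step_inj sesk).
    have /disc_boundaries -> := iBd b.
    by have /= <- := gE b; rewrite g0 lin0.
  have aB : (iB n k, 0, 0) \in boundaries P n by apply/disc_boundaries.
  have [|b bB bE] := step_boundaries sesk fZ aB.
    rewrite [pi n _]fE /= !lin0 !addr0.
    by have -> : pB n (iB n k) = 0 by apply/ex; exists k.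
  exists (Submod bB); apply/eqP; rewrite -subr_eq0; apply/eqP/i0.
  by have /= bE1 := congr1 (fst \o fst) bE; rewrite linB gE /= bE1 subrr.
(* For a cycle [(a, y, 0)] of the kernel, [lH n y] is a boundary, so [y] comes from [KH n]; the
   cycle is a boundary exactly when [y] is zero. *)
- have [KHg _ [i0 ex _]] := EH n.
  have iZ (z : Zmod (ker_complex pi) n) : (ker_incl pi n (val z)).2 = 0.
    by apply/disc_cycles; exact: cycles_map (submod_valP z).
  have [z|g gE] := factor_inj
    (f := snd \o fst \o ker_incl pi n \o incl (cycles (ker_complex pi) n)) i0.
    apply/ex; rewrite -lHE; apply/ZtoH0.
    have : f n (ker_incl pi n (val z)) = 0 by exact: (step_comp sesk).
    rewrite fE iZ lin0 addr0 addrC => /eqP; rewrite addr_eq0 => /eqP ->.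
    by rewrite rpredN; exact: submod_valP.
  have bP x : x \in boundaries (ker_complex pi) n <-> ker_incl pi n x \in boundaries P n.
    split=> [|/(step_boundaries sesk fZ)]; first exact: boundaries_map.
    by rewrite (step_comp sesk) => /(_ erefl)[y yB /(lin_inj (@step_inj _ _ _ _ _ _ sesk _)) <-].
  have g0 z : g z = 0 <-> val z \in boundaries (ker_complex pi) n.
    rewrite bP disc_boundaries; have zE := gE z; split=> [gz|e].
      move: zE (iZ z); rewrite gz lin0 /=.
      by case: (submod_val (submod_val z)) => -[a b] c /= <- ->.
    by apply: i0; rewrite zE /= [submod_val _]e.
  have [z /ZtoH0/g0//|h hE] := factor_surj (f := g) (@ZtoH_surj _ (ker_complex pi) n).
  apply: gorenstein_projective_iso KHg; apply: (bij_mod_iso (f := h)) => [x|k].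
    by have [z <-] := ZtoH_surj x; rewrite hE => /g0/ZtoH0.
  have bB : val (lH n (iH n k)) \in boundaries G' n.
    by apply/ZtoH0; rewrite lHE; apply/ex; exists k.
  have [_ _ [_ _ pS]] := EB n; have [a aE] := pS (Submod bB).
  (* The entry [- a] cancels the boundary [lH n (iH n k)], which places the triple in the kernel. *)
  have [|x xE] := @step_exact _ _ _ _ _ _ sesk n ((- a, iH n k, 0) : P n).
    by rewrite [pi n _]fE /= linN aE lin0 addr0 /= addNr.
  have xZ : x \in cycles (ker_complex pi) n.
    by apply: (step_cycles sesk); rewrite xE; apply/disc_cycles.
  exists (ZtoH _ _ (Submod xZ)); rewrite hE; apply: (lin_inj i0).
  by rewrite gE /= [submod_val _]xE.
Qed.

(** Vanishing of [Ext^1] extends the embeddings [iB] and [iH] to maps [b] and [h] on [G n]; with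
    [iB] after the differential as third slot they form an embedding into [P]. The cokernel has
    boundaries [CB] and homology [CH]. *)
Lemma resolvable_up G : resolvable G -> exists2 G', resolvable G' & complex_step G G'.
Proof.
move=> Gr.
have EB n := gorenstein_projective_hull (let: And3 _ b _ := Gr n in b).
have EH n := gorenstein_projective_hull (let: And3 _ _ b := Gr n in b).
have [CB {}EB] := dep_choice EB; have [PB {}EB] := dep_choice EB.
have [iB {}EB] := dep_choice EB; have [pB {}EB] := dep_choice EB.
have [CH {}EH] := dep_choice EH; have [PH {}EH] := dep_choice EH.
have [iH {}EH] := dep_choice EH; have [pH {}EH] := dep_choice EH.
have PBp n : projective (PB n) by have [] := EB n.
have PHp n : projective (PH n) by have [] := EH n.
have Bx n : ext1_vanishes (Bmod G n).
  by have [_ Bg _] := Gr n; exact: gorenstein_projective_ext1.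
have Hx n : ext1_vanishes (Hmod G n).
  by have [_ _ Hg] := Gr n; exact: gorenstein_projective_ext1.
have Eb n : exists b : {linear G n -> PB n}, forall x, b (val x) = iB n x.
  exact: CmodB_ext1 (predK n) (Hx _) (Bx _) _ _ _ _ _ (iB n) (CmodB_pi_ses G n) (PBp n).
have [b bE] := dep_choice Eb.
(* Extending over [CmodB G n] rather than [G n] makes [h] vanish on boundaries, as compatibility
   with the differentials demands. *)
have Eh n : exists h : {linear G n -> PH n},
    (forall x, x \in boundaries G n -> h x = 0) /\
    forall z, h (val z) = iH n (ZtoH G n z).
  have [i [p [ip iE _]]] := CmodB_ses G (predK n).
  have [h hE] := Bx _ _ _ _ _ _ (iH n) ip (PHp n).
  exists (h \o toCmodB G n); split=> [x /toCmodB0 xB|z]; first by rewrite /= xB lin0.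
  by rewrite /= -iE hE.
have [h {Eh}Eh] := dep_choice Eh.
have hB n x : x \in boundaries G n -> h n x = 0 by have [+ _] := Eh n; exact.
have hE n z : h n (val z) = iH n (ZtoH G n z) by have [_] := Eh n; exact.
pose P := disc PB PH.
have fL n : linear (fun x : G n =>
    (b n x, h n x, iB (n - 1) (diffB G (predK n) x)) : P n).
  by move=> a x y; rewrite !linearP.
pose f n : {linear G n -> P n} := lin_of (fL n).
have fE n x : f n x = (b n x, h n x, iB (n - 1) (diffB G (predK n) x)) by [].
have iB0 n x : iB n x = 0 -> x = 0 by have [_ _ [i0 _ _]] := EB n; exact: i0.
have iH0 n x : iH n x = 0 -> x = 0 by have [_ _ [i0 _ _]] := EH n; exact: i0.
have fC m n (e : m = n + 1) (x : G m) : f n (cdiff G e x) = cdiff P e (f m x).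
  have En : n = m - 1 by rewrite e addrK.
  subst n; rewrite (eq_irrelevance e (predK m)) disc_diffE !fE.
  rewrite hB ?cdiff_boundaries// -val_diffB bE.
  have /diffB0 -> : val (diffB G (predK m) x) \in cycles G (m - 1).
    exact: boundaries_cycles (submod_valP _).
  by rewrite lin0.
pose iota := ChainMap fC.
have fZ n x : (f n x).2 = 0 -> x \in cycles G n.
  by move=> /iB0/diffB0.
have fB n x : (f n x).2 = 0 -> (f n x).1.2 = 0 -> x \in boundaries G n.
  move=> /fZ xZ; have /= -> := hE n (Submod xZ).
  by move=> /iH0/ZtoH0.
have f0 n x : f n x = 0 -> x = 0.
  move=> fx0; have xB : x \in boundaries G n by apply: fB; rewrite fx0.
  move: (congr1 (fst \o fst) fx0) => /=; have /= -> := bE n (Submod xB).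
  by move=> /iB0/(congr1 val).
have fib n (x : Bmod G n) : f n (val x) = (iB n x, 0, 0).
  rewrite fE bE hB ?submod_valP//; congr (_, _, _).
  have /diffB0 -> : val x \in cycles G n by exact: boundaries_cycles (submod_valP x).
  exact: lin0.
pose G' := coker_complex iota; pose pi : chain_map P G' := coker_pi iota.
have ipi n : ses (iota n) (pi n) by exact: (@coker_ses _ _ _ iota n (f0 n)).
(* If [pi n x] is a cycle, the differential of [x] is [iota g], and its zero slots force [g] to be a
   boundary, say of [y]. Then [x - f n y] is a cycle with the same image. *)
have piZ n z' : z' \in cycles G' n -> exists2 z, z \in cycles P n & pi n z = z'.
  have [x <-] := step_surj ipi z'.
  move=> /(cyclesP (predK n)); rewrite -cmapE => /(step_exact ipi)[g].
  rewrite disc_diffE [iota _ g]fE => gx.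
  have /boundariesP-/(_ _ (predK n))[y yE] : g \in boundaries G (n - 1).
    by apply: fB; rewrite fE gx.
  exists (x - f n y); last by rewrite linB [pi n (f n y)](step_comp ipi) subr0.
  apply/disc_cycles.
  rewrite [_.2](_ : _ = x.2 - iB (n - 1) (diffB G (predK n) y)) //.
  apply/eqP; rewrite subr_eq0; apply/eqP.
  have /(congr1 (fst \o fst)) /= <- := gx.
  by rewrite -yE -val_diffB bE.
have B'g n : gorenstein_projective (Bmod G' n).
  have [CBg _ ip] := EB n; have [_ ex _] := ip.
  have L : linear (fun a => (a, 0, 0) : P n).
    by move=> a x y; congr (_, _, _); rewrite /= ?scaler0 ?addr0.
  have aP a : (a, 0, 0) \in boundaries P n by apply/disc_boundaries.
  have [a|v vE] := factor_inj (f := pi n \o lin_of L) (@incl_inj0 _ _ (boundaries G' n)).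
    by exists (Submod (boundaries_map pi (aP a))).
  (* Both [CB n] and the boundaries of [G'] are then cokernels of [iB n]. *)
  suff iv : ses (iB n) v.
    exact: gorenstein_projective_iso (mod_iso_sym (ses_coker_iso ip iv)) CBg.
  split=> [x|a|y]; first exact: iB0.
    split=> [va|[x <-]].
      have [g gE] : exists g, iota n g = (a, 0, 0).
        by apply: (step_exact ipi); have := vE a; rewrite va lin0 => /= <-.
      have gB : g \in boundaries G n by apply: fB; rewrite [f n g]gE.
      exists (Submod gB); rewrite -bE.
      by have /(congr1 (fst \o fst)) := gE.
    apply: incl_inj0; rewrite vE /= -fib.
    exact: (step_comp ipi).
  have [x xy] := step_surj ipi (val y).
  have [|c /disc_boundaries cE cx] := step_boundaries_surj ipi (x := x).
    by rewrite xy submod_valP.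
  exists c.1.1; apply: (lin_inj (@incl_inj0 _ _ (boundaries G' n))).
  by rewrite vE /= -cE cx xy.
have H'g n : gorenstein_projective (Hmod G' n).
  have [CHg _ ip] := EH n; have [_ ex _] := ip.
  have L : linear (fun a => (0, a, 0) : P n).
    by move=> a x y; congr (_, _, _); rewrite /= ?scaler0 ?addr0.
  have aP a : (0, a, 0) \in cycles P n by apply/disc_cycles.
  have [a|w wE] := factor_inj (f := pi n \o lin_of L) (@incl_inj0 _ _ (cycles G' n)).
    by exists (Submod (cycles_map pi (aP a))).
  suff iv : ses (iH n) (ZtoH G' n \o w).
    exact: gorenstein_projective_iso (mod_iso_sym (ses_coker_iso ip iv)) CHg.
  (* Modulo boundaries, the image of an element of [P n] is unchanged by adding a boundary, so only
     the middle slot of a cycle matters in homology. *)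
  have wB a c : c \in boundaries P n -> val (w a) - pi n ((0, a, 0) + c) \in boundaries G' n.
    move=> cB; rewrite [val _]wE linD opprD addrA subrr sub0r rpredN.
    exact: boundaries_map.
  split=> [x|a|y]; first exact: iH0.
    split=> [/ZtoH0|[x <-]].
      rewrite [val _]wE => /(step_boundaries_surj ipi)[c /disc_boundaries cE ca].
      have [g gE] : exists g, iota n g = (0, a, 0) - c.
        by apply: (step_exact ipi); rewrite linB ca subrr.
      have gZ : g \in cycles G n.
        by apply: fZ; rewrite [f n g]gE cE /= subrr.
      exists (ZtoH G n (Submod gZ)); rewrite -hE /=.
      by have /(congr1 (snd \o fst)) /= -> := gE; rewrite cE /= subr0.
    have [z <-] := ZtoH_surj x; apply/ZtoH0.
    have cB : (b n (val z), 0, 0) \in boundaries P n by apply/disc_boundaries.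
    have := wB (iH n (ZtoH G n z)) _ cB.
    have -> : (0, iH n (ZtoH G n z), 0) + (b n (val z), 0, 0) = f n (val z) :> P n.
      rewrite fE hE; congr (_, _, _); rewrite /= ?add0r ?addr0//.
      by have /diffB0 -> := submod_valP z; rewrite lin0.
    by rewrite [pi n _](step_comp ipi) subr0.
  have [z' <-] := ZtoH_surj y; have [z zZ zE] := piZ n _ (submod_valP z').
  exists z.1.2; apply/eqP; rewrite /= -subr_eq0.
  suff /eqP : ZtoH G' n (w z.1.2 - z') = 0 by rewrite linB.
  apply/ZtoH0; have cB : (z.1.1, 0, 0) \in boundaries P n by apply/disc_boundaries.
  have := wB z.1.2 _ cB.
  have -> : (0, z.1.2, 0) + (z.1.1, 0, 0) = z :> P n; last by rewrite zE.
  have /disc_cycles := zZ; case: (z) => -[u v] c /= ->.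
  by congr (_, _, _); rewrite /= ?add0r ?addr0.
have B'x n := gorenstein_projective_ext1 (B'g n).
have H'x n := gorenstein_projective_ext1 (H'g n).
have Pp : CE_projective P by exact: disc_CE_projective.
exists G'; last by exists P, iota, pi.
move=> n; split=> //.
have [Gp _ _] := Gr n; have [Pn _ _ _] := Pp n.
(* [Ext^1] from [G' n] vanishes since [G' n] is built by extensions from two boundary modules and
   one homology module, all Gorenstein projective; so the sequence splits. *)
apply: ses_projective (ipi n) Gp _ Pn.
apply: ext1_vanishes_ses (CmodB_pi_ses G' n) (B'x n) _.
exact: CmodB_ext1 (predK n) (H'x n) (B'x _).
Qed.

Lemma complex_iso_ker G (C D : complex R) (u : chain_map G C) (g : chain_map C D) :
  (forall n x, u n x = 0 -> x = 0) -> (forall n, exact_at (u n) (g n)) ->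
  complex_iso G (ker_complex g).
Proof.
move=> u0 ex; pose K := ker_complex g.
have Ef n : exists f : {linear G n -> K n}, forall x, val (f x) = u n x.
  apply: (@factor_inj _ _ _ _ (incl (ker_mod (g n)))) => [x|x]; first exact: incl_inj0.
  have ux : u n x \in ker_mod (g n) by rewrite unfold_in; apply/eqP/ex; exists x.
  by exists (Submod ux).
have [f fE] := dep_choice Ef.
have Eh n : exists h : {linear K n -> G n}, forall y, u n (h y) = val y.
  apply: (@factor_inj _ _ _ _ (u n) (incl (ker_mod (g n)))) => [x|[x /= /eqP/ex//]].
  exact: u0.
have [h hE] := dep_choice Eh.
have fC m n (e : m = n + 1) x : f n (cdiff G e x) = cdiff K e (f m x).
  by apply: val_inj; rewrite fE cmapE -fE.
have hC m n (e : m = n + 1) y : h n (cdiff K e y) = cdiff G e (h m y).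
  by apply: (lin_inj (u0 n)); rewrite hE cmapE hE.
exists (ChainMap fC), (ChainMap hC) => n; split=> x /=.
  by apply: (lin_inj (u0 n)); rewrite hE fE.
by apply: val_inj; rewrite fE hE.
Qed.

Lemma resolvable_strongly_CE_gorenstein_projective G :
  resolvable G -> strongly_CE_gorenstein_projective G.
Proof.
move=> Gr; pose T := {G | resolvable G}.
pose rel (x y : T) := complex_step (sval x) (sval y).
have [||t [t0 tE]] := @int_chain T rel (exist _ _ Gr).
- by move=> [N SN]; have [N' SN' st] := resolvable_up SN; exists (exist _ _ SN').
- by move=> [N SN]; have [N' SN' st] := resolvable_down SN; exists (exist _ _ SN').
have [K [K0 Kr KE]] : exists K : int -> complex R,
    [/\ K 0 = G, forall i, resolvable (K i) & forall i, complex_step (K i) (K (i + 1))].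
  by exists (fun i => sval (t i)); split=> // [|i]; [rewrite t0|exact: svalP].
have [P {}KE] := dep_choice KE; have [iota {}KE] := dep_choice KE.
have [pi {}KE] := dep_choice KE.
have Pp i : CE_projective (P i) by have [] := KE i.
have ip i n : ses (iota i n) (pi i n) by have [_ + _] := KE i; exact.
have cl i n z' : z' \in cycles (K (i + 1)) n ->
    exists2 z, z \in cycles (P i) n & pi i n z = z'.
  by have [_ _] := KE i; exact.
pose f i := comp_chain_map (iota (i + 1)) (pi i).
exists P, f; split=> //.
- split; first split=> [n|].
  + exact: (splice_exact (iota := fun i => iota i n) (pi := fun i => pi i n)).
  + split=> n.
    * apply: (splice_exact (iota := fun i => Zmap (iota i) n)
        (pi := fun i => Zmap (pi i) n)) => i; first exact: (step_Z (ip i) (cl i)).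
      by move=> x; apply: val_inj.
    * apply: (splice_exact (iota := fun i => Bmap (iota i) n)
        (pi := fun i => Bmap (pi i) n)) => i; first exact: (step_B (ip i) (cl i)).
      by move=> x; apply: val_inj.
    * apply: (splice_exact (iota := fun i => CmodZ_map (iota i) n)
        (pi := fun i => CmodZ_map (pi i) n)) => i; first exact: (step_CmodZ (ip i) (cl i)).
      by move=> x; have [y <-] := quot_pi_surj x; rewrite !quot_CmodZ_map.
    * apply: (splice_exact (iota := fun i => CmodB_map (iota i) n)
        (pi := fun i => CmodB_map (pi i) n)) => i; first exact: (step_CmodB (ip i) (cl i)).
      by move=> x; have [y <-] := toCmodB_surj x; rewrite !toCmodB_map.
    * apply: (splice_exact (iota := fun i => Hmap (iota i) n)
        (pi := fun i => Hmap (pi i) n)) => i; first exact: (step_H (ip i) (cl i)).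
      move=> x; have [y <-] := ZtoH_surj x; rewrite !ZtoH_map.
      by congr (ZtoH _ _ _); apply: val_inj.
  (* The kernel of [f (i + 1) n] is identified with [K (i + 1) n], whose projectivity splits
     [pi i n]. *)
  + move=> n i; have [Kp _ _] := Kr (i + 1) n.
    have [s sK] := ses_section (ip i n) Kp.
    have [z|g gE] := factor_inj (f := incl (ker_mod (f (i + 1) n))) (step_inj (ip (i + 1)) (n := n)).
      case: z => z /= /eqP/(step_inj (ip _)).
      exact: (step_exact (ip (i + 1))).
    by exists (s \o g) => z; rewrite /= sK gE.
- rewrite -K0; apply: (complex_iso_ker (u := iota 0)) => n.
    exact: (step_inj (ip 0)).
  move=> x; split=> [/= /(step_inj (ip _))/(step_exact (ip 0))//|[g <-]].
  by rewrite /= (step_comp (ip 0)) lin0.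
- move=> Q Qp i g; split=> [g0|[h hE] n x]; last first.
    by rewrite -hE /= (step_comp (ip (i + 1))) !lin0.
  have Kx n : projective (K (i + 1 + 1 + 1) n) by have [] := Kr (i + 1 + 1 + 1) n.
  have Cx n : ext1_vanishes (CmodB (K (i + 1 + 1 + 1)) n).
    have [_ _ Hg] := Kr (i + 1 + 1 + 1) n; have [_ Bg _] := Kr (i + 1 + 1 + 1) (n - 1).
    by apply: (CmodB_ext1 (predK n)); exact: gorenstein_projective_ext1.
  (* The map [g] descends to a chain map on [K (i + 1 + 1)], which [step_chain_ext] then extends
     along [iota (i + 1 + 1)]. *)
  have Ek n : exists k : {linear K (i + 1 + 1) n -> Q n},
      forall x, k (pi (i + 1) n x) = g n x.
    apply: factor_surj => [|x]; first exact: (step_surj (ip (i + 1))).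
    move=> /(step_exact (ip (i + 1)))[y <-].
    by have [z <-] := step_surj (ip i) y; exact: g0.
  have [k kE] := dep_choice Ek.
  have kC m n (e : m = n + 1) x : k n (cdiff (K (i + 1 + 1)) e x) = cdiff Q e (k m x).
    by have [y <-] := step_surj (ip (i + 1)) x; rewrite -cmapE !kE cmapE.
  have [h hE] := step_chain_ext (ip _) (cl _) (ChainMap kC) Kx Cx Qp.
  by exists h => n y; rewrite /= hE; exact: kE.
Qed.

End Resolution.

(** * Components of a strongly C-E exact sequence *)

Section HomExtension.
Variable R : pzRingType.
Variables (M : int -> lmodType R) (f : forall i, {linear M i -> M (i + 1)}).
Implicit Types Q : lmodType R.

Definition hom_ext_at Q i := forall g : {linear M (i + 1) -> Q},
  (forall x, g (f i x) = 0) ->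
  exists h : {linear M (i + 1 + 1) -> Q}, forall y, h (f (i + 1) y) = g y.

(** Every integer has the form [i + 1 + 1], so the extension property may be proved at shifted
    indices, where earlier terms of the sequence are available without transport. *)
Lemma hom_ext_exact Q : exact_seq f -> (forall i, hom_ext_at Q (i + 1 + 1)) ->
  hom_exact_seq f Q.
Proof.
move=> fE fX i g; split=> [|[h hE] x].
  suff : hom_ext_at Q i by exact.
  by rewrite -(subrK 1 i) -(subrK 1 (i - 1)).
rewrite -hE; have -> : f (i + 1) (f i x) = 0; last exact: lin0.
by apply/fE; exists x.
Qed.

Lemma split_ker_projective i : (forall i, projective (M i)) -> exact_seq f ->
  split_seq f -> projective (submod (ker_mod (f i))).
Proof.
move=> Mp fE fs; rewrite -(subrK 1 i); have [s sE] := fs (i - 1).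
have [p pE] := exact_corestriction (i - 1) fE.
apply: (@projective_retract _ _ _ s p) => // z.
by apply: val_inj; rewrite pE sE.
Qed.

(** The map [g] factors through the kernel of [f (i + 1 + 1)], which is a direct summand of
    [M (i + 1 + 1)] because the next kernel is projective. *)
Lemma split_hom_ext Q i : (forall i, projective (M i)) -> exact_seq f ->
  split_seq f -> hom_ext_at Q i.
Proof.
move=> Mp fE fs g g0.
have [p pE] := exact_corestriction (i + 1) fE.
have [q qE] := exact_corestriction (i + 1 + 1) fE.
have ps := exact_corestriction_ses fE pE; have [_ _ pS] := ps.
have qs := exact_corestriction_ses fE qE.
have [r rE] := ses_retraction qs (split_ker_projective Mp fE fs).
have [x|k kE] := factor_surj (f := g) pS.
  by move=> /(congr1 val); rewrite pE => /fE[y <-].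
exists (k \o r) => y; rewrite -kE /=; congr (k _).
by rewrite -[RHS]rE -pE.
Qed.

End HomExtension.

(** * Complete resolutions of cycles, boundaries and homology *)

Section Necessity.
Variable R : pzRingType.
Implicit Types (C D : complex R) (Q : lmodType R).

Lemma ext_killing_boundaries C n Q (g : {linear Hmod C n -> Q}) :
  ext1_vanishes (Bmod C (n - 1)) -> projective Q ->
  exists h : {linear C n -> Q},
    (forall x, x \in boundaries C n -> h x = 0) /\
    forall z, h (val z) = g (ZtoH C n z).
Proof.
move=> Bx Qp; have [i [p [ip iE _]]] := CmodB_ses C (predK n).
have [h hE] := Bx _ _ _ _ _ g ip Qp.
exists (h \o toCmodB C n); split=> [x /toCmodB0 xB|z]; first by rewrite /= xB lin0.
by rewrite /= -iE hE.
Qed.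

Variables (P : int -> complex R) (f : forall i, chain_map (P i) (P (i + 1))).
Hypothesis Pp : forall i, CE_projective (P i).
Hypothesis fE : strongly_CE_exact f.
Hypothesis fX : forall Q : complex R, CE_projective Q -> hom_exact_cseq f Q.

Lemma seq_exact n : exact_seq (fun i => f i n).
Proof. by have [[]] := fE. Qed.

Lemma seq_comp i n x : f (i + 1) n (f i n x) = 0.
Proof. by apply/seq_exact; exists x. Qed.

Lemma term_projective i n : projective (P i n).
Proof. by have [] := Pp i n. Qed.

Lemma boundaries_ext1 i n : ext1_vanishes (Bmod (P i) n).
Proof. by have [_ _ Bp _] := Pp i n; exact: projective_ext1. Qed.

Lemma homology_ext1 i n : ext1_vanishes (Hmod (P i) n).
Proof. by have [_ _ _ Hp] := Pp i n; exact: projective_ext1. Qed.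

Lemma term_hom_ext i n Q : hom_ext_at (fun i => f i n) Q i.
Proof.
have [_ fs] := fE; apply: split_hom_ext => // [j|]; last exact: seq_exact.
exact: term_projective.
Qed.

(* Maps [C n -> Q] killing the boundaries are the chain maps from [C] to the
   sphere on [Q] in degree [n].  The constant families used for [S] contain that
   sphere as a summand and avoid a family of modules defined by cases. *)
Lemma CmodB_hom_ext i n Q (g : {linear P (i + 1) n -> Q}) : projective Q ->
  (forall x, x \in boundaries (P (i + 1)) n -> g x = 0) ->
  (forall x, g (f i n x) = 0) ->
  exists2 h : {linear P (i + 1 + 1) n -> Q},
    forall y, h (f (i + 1) n y) = g y &
    forall x, x \in boundaries (P (i + 1 + 1)) n -> h x = 0.
Proof.
move=> Qp gB gf; pose S := disc (fun=> Q) (fun=> Q).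
have Sp : CE_projective S by exact: disc_CE_projective.
(* The map is [g] in the sphere slot in degree [n] and zero in the other degrees; the last clause
   lets [g] be recovered after the family is chosen. *)
have Ek m : exists k : {linear P (i + 1) m -> S m},
    [/\ forall x, x \in boundaries (P (i + 1)) m -> k x = 0,
        forall x, (k x).2 = 0, forall x, k (f i m x) = 0
      & forall e : n = m, forall x, (k (transport (P (i + 1)) e x)).1.2 = g x].
  case: (n =P m) => [e|ne]; last first.
    have L : linear (fun x : P (i + 1) m => 0 : S m).
      by move=> a x y; rewrite scaler0 addr0.
    by exists (lin_of L); split=> //.
  subst m.
  have L : linear (fun x => (0, g x, 0) : S n).
    by move=> a x y; rewrite linearP; congr (_, _, _); rewrite /= ?scaler0 ?addr0.
  exists (lin_of L); split=> // [x /gB /= ->//|x|e x]; first by rewrite /= gf.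
  by rewrite transport_id.
have [k kE] := dep_choice Ek.
have kC m p (e : m = p + 1) x : k p (cdiff (P (i + 1)) e x) = cdiff S e (k m x).
  have [kB _ _ _] := kE p; have [_ k2 _ _] := kE m.
  rewrite kB ?cdiff_boundaries//; symmetry; apply/(cyclesP e).
  by apply/disc_cycles; exact: k2.
have [m x|h hE] := (fX Sp (ChainMap kC)).1.
  by have [_ _ kf _] := kE m; exact: kf.
exists (snd \o fst \o h n) => [y|x /(boundariesP erefl)[y <-]].
  rewrite /= hE; have [_ _ _ kg] := kE n.
  by have := kg erefl y.
(* A differential in [S] has zero sphere slot. *)
by rewrite /= cmapE.
Qed.

(** First [g] extends to [g1] on the whole term. By [CmodB_hom_ext] there is a [k] that kills
    boundaries and agrees with [g1] on the image of [f (i + 1)]; hence [g1 \- k] still restricts to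
    [g] and extends along the degreewise split sequence. *)
Lemma B_hom_ext i n Q : projective Q ->
  hom_ext_at (fun i => Bmap (f i) n) Q (i + 1).
Proof.
move=> Qp g gf.
have Cx : ext1_vanishes (CmodB (P (i + 1 + 1)) n).
  by apply: (CmodB_ext1 (predK n)); [exact: homology_ext1|exact: boundaries_ext1].
have [g1 g1E] := Cx _ _ _ _ _ g (CmodB_pi_ses _ n) Qp.
have [x xB|x|k kE kB] := @CmodB_hom_ext i n Q (g1 \o f (i + 1) n) Qp.
- rewrite /=; have := g1E (Bmap (f (i + 1)) n (Submod xB)); rewrite gf /= => <-.
  by [].
- by rewrite /= seq_comp lin0.
have [x|h hE] := @term_hom_ext (i + 1) n Q (g1 \- k).
  by rewrite /= kE /= subrr.
exists (h \o incl _) => b; rewrite /= hE /= kB ?submod_valP// subr0.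
exact: g1E.
Qed.

(* Corrects an extension of a map defined on cycles or homology to one that is
   killed by [f]. *)
Lemma hom_ext_correction i n Q (g : {linear P (i + 1 + 1 + 1) n -> Q}) :
  projective Q ->
  (forall z, z \in cycles (P (i + 1 + 1)) n -> g (f (i + 1 + 1) n z) = 0) ->
  exists k : {linear Bmod (P (i + 1 + 1 + 1)) (n - 1) -> Q},
    forall x, k (diffB _ (predK n) (f (i + 1 + 1) n x)) = g (f (i + 1 + 1) n x).
Proof.
move=> Qp gZ; have fB j x : Bmap (f j) (n - 1) (diffB _ (predK n) x) =
    diffB _ (predK n) (f j n x).
  by apply: val_inj; rewrite /= [submod_val _]val_diffB [RHS]val_diffB cmapE.
have [x /diffB0/gZ//|k0 k0E] := factor_surj (f := g \o f (i + 1 + 1) n)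
  (diffB_surj (predK n)).
(* The induced map [k0] on boundaries kills the image of [f (i + 1)], so exactness on boundaries in
   degree [n - 1] applies. *)
have [b|k kE] := B_hom_ext (i := i) Qp (g := k0).
  have [x <-] := diffB_surj (predK n) b.
  by rewrite fB k0E /= seq_comp lin0.
by exists k => x; rewrite -fB kE k0E.
Qed.

(** An extension [g1] of [g] to the whole term is corrected by a map factoring through the
    differential, which leaves its values on cycles unchanged. *)
Lemma Z_hom_ext i n Q : projective Q ->
  hom_ext_at (fun i => Zmap (f i) n) Q (i + 1 + 1).
Proof.
move=> Qp g gf.
have [g1 g1E] := boundaries_ext1 g (cycles_ses _ (predK n)) Qp.
have [z zZ|k kE] := @hom_ext_correction i n Q g1 Qp.
  by have := g1E (Zmap (f (i + 1 + 1)) n (Submod zZ)); rewrite gf.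
have [x|h hE] := @term_hom_ext (i + 1 + 1) n Q (g1 \- (k \o diffB _ (predK n))).
  by rewrite /= kE subrr.
exists (h \o incl _) => z; rewrite /= hE /=.
have /diffB0 -> := submod_valP z; rewrite lin0 subr0.
exact: g1E.
Qed.

(** As for cycles, but every map is kept zero on boundaries: [CmodB_hom_ext] replaces
    [term_hom_ext], so the final extension descends to homology. *)
Lemma H_hom_ext i n Q : projective Q ->
  hom_ext_at (fun i => Hmap (f i) n) Q (i + 1 + 1).
Proof.
move=> Qp g gf.
have [g1 [g1B g1E]] := ext_killing_boundaries g (@boundaries_ext1 _ _) Qp.
have [z zZ|k kE] := @hom_ext_correction i n Q g1 Qp.
  by have := g1E (Zmap (f (i + 1 + 1)) n (Submod zZ)); rewrite -ZtoH_map gf.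
have [x xB|x|h hE hB] :=
  @CmodB_hom_ext (i + 1 + 1) n Q (g1 \- (k \o diffB _ (predK n))) Qp.
- rewrite /= g1B//; have /diffB0 -> := boundaries_cycles xB.
  by rewrite lin0 subr0.
- by rewrite /= kE subrr.
have [z /ZtoH0/hB//|h' h'E] := factor_surj (f := h \o incl _)
  (@ZtoH_surj _ (P (i + 1 + 1 + 1 + 1)) n).
exists h' => q; have [z <-] := ZtoH_surj q.
rewrite ZtoH_map h'E /= hE /=.
have /diffB0 -> := submod_valP z; rewrite lin0 subr0.
exact: g1E.
Qed.

(** Exactness on boundaries writes [b] as the image of a boundary from the previous complex; the
    image of a preimage under its differential is the required [x]. *)
Lemma kernel_boundaries i n b : b \in boundaries (P i) n -> f i n b = 0 ->
  exists2 x, f i (n + 1) x = 0 & cdiff (P i) erefl x = b.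
Proof.
have [j ij] : exists j, i = j + 1 by exists (i - 1); rewrite subrK.
subst i => bB b0.
have [[_ [_ exB _ _ _]] _] := fE.
have [|y yE] := (exB n j (Submod bB)).1; first exact: val_inj.
have /(boundariesP erefl)[x xE] := submod_valP y.
exists (f j (n + 1) x); first exact: seq_comp.
by rewrite -cmapE xE; have := congr1 val yE.
Qed.

(** Exactness on homology writes the class of [z] as the image of a class from the previous complex;
    the image of a representative is the required [y]. *)
Lemma kernel_cycles i n z : z \in cycles (P i) n -> f i n z \in boundaries (P (i + 1)) n ->
  exists2 y, f i n y = 0 & z - y \in boundaries (P i) n.
Proof.
have [j ij] : exists j, i = j + 1 by exists (i - 1); rewrite subrK.
subst i => zZ zB.
have [[_ [_ _ _ _ exH]] _] := fE.
have [|q] := (exH n j (ZtoH _ _ (Submod zZ))).1.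
  by rewrite ZtoH_map; apply/ZtoH0.
have [y <-] := ZtoH_surj q; rewrite ZtoH_map => e.
exists (f j n (val y)); first exact: seq_comp.
have /ZtoH0 : ZtoH (P (j + 1)) n (Submod zZ - Zmap (f j) n y) = 0.
  by rewrite linB e subrr.
by [].
Qed.

(** The maps induced by [u] identify the cycles, boundaries and homology of [G] with kernels of the
    maps induced by [f 0]; boundaries need [kernel_boundaries], and homology also needs
    [kernel_cycles]. *)
Lemma kernel_gorenstein_projective G : complex_iso G (ker_complex (f 0)) ->
  forall n, [/\ projective (G n), gorenstein_projective (Zmod G n),
    gorenstein_projective (Bmod G n) & gorenstein_projective (Hmod G n)].
Proof.
move=> [phi [psi phiK]] n; pose u := comp_chain_map (ker_incl (f 0)) phi.
have u0 m x : u m x = 0 -> x = 0.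
  move=> /(@incl_inj0 _ _ (ker_mod (f 0 m))) e; have [phiK1 _] := phiK m.
  by rewrite -[x]phiK1 e lin0.
have uex m x : f 0 m x = 0 -> exists g, u m g = x.
  move=> fx; have xk : x \in ker_mod (f 0 m) by rewrite unfold_in fx.
  by exists (psi m (Submod xk)); have [_ e] := phiK m; rewrite /= e.
have fu m x : f 0 m (u m x) = 0.
  by rewrite /=; case: (phi m x) => y /= /eqP.
have ucyc x : u n x \in cycles (P 0) n -> x \in cycles G n.
  move=> /(cyclesP (predK n)); rewrite -cmapE => /u0 x0.
  exact/(cyclesP (predK n)).
have ubd b : b \in boundaries (P 0) n -> f 0 n b = 0 ->
    exists2 g, g \in boundaries G n & u n g = b.
  move=> bB /(kernel_boundaries bB)[x /uex[g <-] <-].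
  by exists (cdiff G erefl g); [exact: cdiff_boundaries|rewrite cmapE].
have [[_ [exZ exB _ _ exH]] fs] := fE.
split.
- apply: (@projective_retract _ _ _ (phi n) (psi n)); first by have [] := phiK n.
  apply: (split_ker_projective (M := fun i => P i n) (f := fun i => f i n) (i := 0)) => //.
  + by move=> i; exact: term_projective.
  + exact: seq_exact.
- exists (fun i => Zmod (P i) n), (fun i => Zmap (f i) n); split=> //.
  + by move=> i; have [] := Pp i n.
  + apply: (mod_iso_ker (u := Zmap u n)) => [x|z].
      by move=> /(congr1 val)/u0 x0; exact: val_inj.
    split=> [/(congr1 val)/uex[g gE]|[g <-]]; last by apply: val_inj; exact: fu.
    have gZ : g \in cycles G n by apply: ucyc; rewrite gE submod_valP.
    by exists (Submod gZ); apply: val_inj.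
  + move=> Q Qp; apply: hom_ext_exact => // i; exact: Z_hom_ext.
- exists (fun i => Bmod (P i) n), (fun i => Bmap (f i) n); split=> //.
  + by move=> i; have [] := Pp i n.
  + apply: (mod_iso_ker (u := Bmap u n)) => [x|z].
      by move=> /(congr1 val)/u0 x0; exact: val_inj.
    split=> [/(congr1 val)/(ubd _ (submod_valP z))[g gB gE]|[g <-]].
      by exists (Submod gB); apply: val_inj.
    by apply: val_inj; exact: fu.
  + move=> Q Qp; apply: hom_ext_exact => // i; exact: B_hom_ext.
- exists (fun i => Hmod (P i) n), (fun i => Hmap (f i) n); split=> //.
  + by move=> i; have [] := Pp i n.
  + apply: (mod_iso_ker (u := Hmap u n)) => q; have [z <-] := ZtoH_surj q.
      rewrite ZtoH_map => /ZtoH0/ubd-/(_ (fu _ _))[g gB].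
      by move=> /(lin_inj (u0 n)) gz; apply/ZtoH0; rewrite -gz.
    rewrite ZtoH_map; split=> [/ZtoH0/(kernel_cycles (submod_valP z))|].
      move=> [y /uex[g <-] zB].
      have gZ : g \in cycles G n.
        apply: ucyc; rewrite -[u n g](subKr (val z)) rpredB ?submod_valP//.
        exact: boundaries_cycles.
      exists (ZtoH _ _ (Submod gZ)); rewrite ZtoH_map.
      have /ZtoH0 : val (z - Zmap u n (Submod gZ)) \in boundaries (P 0) n by [].
      by rewrite linB => /eqP; rewrite subr_eq0 => /eqP.
    move=> [q']; have [g <-] := ZtoH_surj q'; rewrite ZtoH_map => e.
    rewrite -ZtoH_map -e !ZtoH_map.
    have -> : Zmap (f 0) n (Zmap u n g) = 0; last exact: lin0.
    by apply: val_inj; exact: fu.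
  + move=> Q Qp; apply: hom_ext_exact => // i; exact: H_hom_ext.
Qed.

End Necessity.

Theorem theorem1p3 (R : pzRingType) (G : complex R) :
  strongly_CE_gorenstein_projective G <->
  (forall n : int,
     [/\ projective (G n),
         gorenstein_projective (Zmod G n),
         gorenstein_projective (Bmod G n)
       & gorenstein_projective (Hmod G n)]).
Proof.
split=> [[P [f [Pp fE Gf fX]]]|GP].
  exact: (kernel_gorenstein_projective Pp fE fX Gf).
apply: resolvable_strongly_CE_gorenstein_projective => n.
by have [] := GP n.
Qed.
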